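(* Suppose that the series $$r(x,y)=\frac{s(y)\Omega}{x-y}+g(x,y)\in(\mathfrak{g}\otimes\mathfrak{g})(\!(x)\!)[\![y]\!],\qquad s\in F[\![y]\!],\ g\in(\mathfrak{g}\otimes\mathfrak{g})[\![x,y]\!],$$ solves the formal classical Yang-Baxter equation. Then either $s=0$ or $s$ has a zero at $y=0$ of multiplicity $0$, $1$ or $2$. Furthermore, there are $\psi\in xF[\![x]\!]^\times$ and $\xi\in F^\times$ such that $\xi\, r(\psi(x),\psi(y))=\frac{\tilde s(y)\Omega}{x-y}+\tilde g(x,y)$ with $\tilde g\in(\mathfrak{g}\otimes\mathfrak{g})[\![x,y]\!]$ and $\tilde s\in\{0,1,y,y^2\}$. In the case that $s$ has a zero of multiplicity $2$, the existence of such a transformation (to $\tilde s=y^2$) is equivalent to the vanishing of the coefficient of $y^3$ in $s(y)$.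
   Context: $F$ is an algebraically closed field of characteristic $0$, $\mathfrak{g}$ a finite-dimensional simple Lie algebra over $F$, $\Omega=\sum_\alpha I_\alpha\otimes I_\alpha\in\mathfrak{g}\otimes\mathfrak{g}$ for an orthonormal basis $\{I_\alpha\}$ of $\mathfrak{g}$ with respect to the Killing form. In $(\mathfrak{g}\otimes\mathfrak{g})(\!(x)\!)[\![y]\!]$ one sets $\frac1{x-y}=\sum_{k\ge0}x^{-k-1}y^k$. The formal classical Yang-Baxter equation is $[r^{12}(x_1,x_2),r^{13}(x_1,x_3)]+[r^{12}(x_1,x_2),r^{23}(x_2,x_3)]+[r^{13}(x_1,x_3),r^{23}(x_2,x_3)]=0$ in $(\mathfrak{g}^{\otimes3})(\!(x_1)\!)(\!(x_2)\!)[\![x_3]\!]$, with the usual leg notation (e.g. $[(a\otimes b)^{13},(c\otimes d)^{23}]=a\otimes c\otimes[b,d]$). $xF[\![x]\!]^\times$ is the set of power series with zero constant term and non-zero linear coefficient. *)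

(* Defs.v *)
From HB Require Import structures.
From mathcomp Require Import all_boot all_order all_algebra.
From mathcomp Require Import boolp classical_sets functions cardinality fsbigop.

Set Implicit Arguments.
Unset Strict Implicit.
Unset Printing Implicit Defensive.
Import Order.TTheory GRing.Theory Num.Theory.
Local Open Scope ring_scope.

Definition fps (R : Type) : Type := nat -> R.

HB.instance Definition _ (F : fieldType) :=
  GRing.Zmodule.copy (fps F) (nat -> F).

Definition fps_one (F : fieldType) : fps F := fun n => (n == 0%N)%:R.
Definition fps_mul (F : fieldType) (f g : fps F) : fps F :=
  fun n => \sum_(i < n.+1) f i * g (n - i)%N.

Definition fps_trunc (F : fieldType) (n : nat) (f : fps F) : {poly F} :=
  \poly_(i < n) f i.

Lemma fps_mul_trunc (F : fieldType) (f g : fps F) (N n : nat) : (n < N)%N ->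
  fps_mul f g n = (fps_trunc N f * fps_trunc N g)`_n.
Proof.
move=> nN; rewrite coefM; apply: eq_bigr => i _; rewrite !coef_poly.
by rewrite (leq_ltn_trans (leq_subr _ _) nN) (leq_ltn_trans _ nN) // -ltnS.
Qed.

Lemma fps_trunc_mul (F : fieldType) (p : {poly F}) (f g : fps F) (N n : nat) :
  (n < N)%N ->
  (p * fps_trunc N (fps_mul f g))`_n
  = (p * (fps_trunc N f * fps_trunc N g))`_n.
Proof.
move=> nN; rewrite !coefM; apply: eq_bigr => i _; congr (_ * _).
have iN : (n - i < N)%N by rewrite (leq_ltn_trans (leq_subr _ _)).
by rewrite coef_poly iN (fps_mul_trunc _ _ iN).
Qed.

Lemma fps_mulC (F : fieldType) : commutative (@fps_mul F).
Proof.
by move=> f g; apply/funext => n; rewrite !(fps_mul_trunc _ _ (ltnSn n)) mulrC.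
Qed.

Lemma fps_mulA (F : fieldType) : associative (@fps_mul F).
Proof.
move=> f g h; apply/funext => n.
rewrite [LHS](fps_mul_trunc _ _ (ltnSn n)) fps_trunc_mul // mulrA.
rewrite [RHS](fps_mul_trunc _ _ (ltnSn n)) [in RHS]mulrC fps_trunc_mul //.
by rewrite [in RHS]mulrC.
Qed.

Lemma fps_mul1 (F : fieldType) : left_id (fps_one F) (@fps_mul F).
Proof.
move=> f; apply/funext => n; rewrite /fps_mul big_ord_recl subn0 mul1r.
by rewrite big1 ?addr0 // => i _; rewrite mul0r.
Qed.

Lemma fps_mulDl (F : fieldType) : left_distributive (@fps_mul F) +%R.
Proof.
move=> f g h; apply/funext => n.
transitivity (fps_mul f h n + fps_mul g h n); last by [].
by rewrite -big_split; apply: eq_bigr => i _ /=; rewrite -mulrDl.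
Qed.

Lemma fps_one_neq0 (F : fieldType) : fps_one F != 0.
Proof.
apply/eqP => /(congr1 (fun f : fps F => f 0%N)) /eqP.
by rewrite /fps_one eqxx oner_eq0.
Qed.

HB.instance Definition _ (F : fieldType) :=
  GRing.Zmodule_isComNzRing.Build (fps F)
    (@fps_mulA F) (@fps_mulC F) (@fps_mul1 F) (@fps_mulDl F) (@fps_one_neq0 F).


(* The coefficients of degree < n of the inverse of f, highest degree first,
   from the recursion f_0 h_m = [m = 0] - \sum_(i < m) f_(i+1) h_(m-1-i). *)
Fixpoint fps_inv_seq (F : fieldType) (f : fps F) (n : nat) : seq F :=
  if n is m.+1 then
    let h := fps_inv_seq f m in
    (f 0%N)^-1 * ((m == 0%N)%:R - \sum_(i < m) f i.+1 * h`_i) :: h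
  else [::].

Definition fps_inv (F : fieldType) (f : fps F) : fps F :=
  if f 0%N == 0 then f else fun n => (fps_inv_seq f n.+1)`_0.

Lemma fps_inv_seq_nth (F : fieldType) (f : fps F) (n i : nat) : (i < n)%N ->
  (fps_inv_seq f n)`_i = (fps_inv_seq f (n - i))`_0.
Proof.
elim: n i => // n IHn [|i] ni; first by rewrite subn0.
by rewrite subSS -IHn.
Qed.

Lemma fps_mulV (F : fieldType) :
  {in [pred f : fps F | f 0%N != 0], left_inverse 1 (@fps_inv F) *%R}.
Proof.
move=> f /[!inE] f0; rewrite mulrC; apply/funext => n.
change (\sum_(i < n.+1) f i * fps_inv f (n - i)%N = (n == 0%N)%:R).
rewrite big_ord_recl subn0 /fps_inv (negPf f0) [fps_inv_seq f n.+1]/= [_`_0]/= mulVKf //.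
rewrite -addrA [X in _ + X](_ : _ = 0) ?addr0 // addrC; apply/eqP.
rewrite subr_eq0; apply/eqP/eq_bigr => i _.
by rewrite [in RHS]fps_inv_seq_nth -?(subnSK (ltn_ord i)).
Qed.

Lemma fps_unitP (F : fieldType) (f h : fps F) :
  h * f = 1 -> f \in [pred f : fps F | f 0%N != 0].
Proof.
move=> /(congr1 (fun f : fps F => f 0%N)) /eqP; rewrite inE.
change (\sum_(i < 1) h i * f (0 - i)%N == 1 -> f 0%N != 0); rewrite big_ord1 /=.
by apply: contraTneq => ->; rewrite mulr0 eq_sym oner_eq0.
Qed.

Lemma fps_inv_out (F : fieldType) :
  {in [predC [pred f : fps F | f 0%N != 0]], @fps_inv F =1 id}.
Proof. by move=> f; rewrite !inE negbK /fps_inv => ->. Qed.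

HB.instance Definition _ (F : fieldType) :=
  GRing.ComNzRing_hasMulInverse.Build (fps F)
    (@fps_mulV F) (@fps_unitP F) (@fps_inv_out F).

Definition fpsX (F : fieldType) : fps F := fun n => (n == 1%N)%:R.

HB.mixin Record Vector_isLie (F : fieldType) L of Vector F L := {
  lie : L -> L -> L;
  lie_linearl : forall z, linear (fun x => lie x z);
  lie_linearr : forall x, linear (lie x);
  liexx : forall x, lie x x = 0;
  lie_jacobi : forall x y z,
    lie x (lie y z) + lie y (lie z x) + lie z (lie x y) = 0
}.

#[short(type="lieAlgType")]
HB.structure Definition LieAlgebra (F : fieldType) :=
  {L of Vector_isLie F L & Vector F L}.

Notation "[ 'Lie' x , y ]" := (lie x y)
  (at level 0, x at level 99, y at level 99, format "[ 'Lie'  x ,  y ]").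

Definition lie_ideal (F : fieldType) (L : lieAlgType F) (U : {vspace L}) : Prop :=
  forall x y : L, y \in U -> [Lie x, y] \in U.

Definition lie_simple (F : fieldType) (L : lieAlgType F) : Prop :=
  (exists x y : L, [Lie x, y] != 0) /\
  (forall U : {vspace L}, lie_ideal U -> U = 0%VS \/ U = fullv).

Definition killing (F : fieldType) (L : lieAlgType F) (x y : L) : F :=
  \tr (passmx.mxof (vbasis {:L}) (vbasis {:L})
         (linfun (fun z => [Lie x, [Lie y, z]]))).

Lemma killingE (F : fieldType) (L : lieAlgType F) (x y : L) :
  killing x y =
  \sum_i coord (vbasis {:L}) i [Lie x, [Lie y, (vbasis {:L})`_i]].
Proof.
have adL : linear (fun z => [Lie x, [Lie y, z]]).
  by move=> a u v; rewrite lie_linearr lie_linearr.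
pose adM := GRing.isLinear.Build _ _ _ _ _ adL.
pose ad : {linear L -> L} := HB.pack (fun z => [Lie x, [Lie y, z]]) adM.
apply: eq_bigr => i _; rewrite !mxE /= passmx.vecof_delta.
by rewrite (lfunE ad).
Qed.

Definition killing_orthonormal (F : fieldType) (L : lieAlgType F) (n : nat)
    (e : n.-tuple L) : Prop :=
  forall i j : 'I_n, killing e`_i e`_j = (i == j)%:R.

(* V (x) W in coordinates: the entry (i, j) is the coefficient of
   v_i (x) w_j, for the bases v = vbasis {:V} and w = vbasis {:W}. *)
Definition tensor (F : fieldType) (V W : vectType F) : Type :=
  'M[F]_(\dim {:V}, \dim {:W}).

HB.instance Definition _ (F : fieldType) (V W : vectType F) :=
  Vector.copy (tensor V W) 'M[F]_(\dim {:V}, \dim {:W}).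

Definition tens (F : fieldType) (V W : vectType F) (v : V) (w : W) :
    tensor V W :=
  \matrix_(i, j) (coord (vbasis {:V}) i v * coord (vbasis {:W}) j w).

Notation "v ⊗ w" := (tens v w) (at level 40, left associativity).

Definition tensor3 (F : fieldType) (V : vectType F) : vectType F :=
  tensor (tensor V V) V.

(* The value at (T, S) of the bilinear map that sends (a ⊗ b, c ⊗ d) to
   phi a b c d, for a 4-linear map phi; see [tens_lift_tens]. *)
Definition tens_lift (F : fieldType) (V U : vectType F)
    (phi : V -> V -> V -> V -> U) (T S : tensor V V) : U :=
  let e := vbasis {:V} in
  \sum_i \sum_j \sum_k \sum_l (T i j * S k l) *: phi e`_i e`_j e`_k e`_l.

Definition linear4 (F : fieldType) (V U : vectType F)
    (phi : V -> V -> V -> V -> U) : Prop :=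
  [/\ forall b c d, linear (fun a => phi a b c d),
      forall a c d, linear (fun b => phi a b c d),
      forall a b d, linear (fun c => phi a b c d) &
      forall a b c, linear (phi a b c)].


Lemma linear_coord_sum (F : fieldType) (V U : vectType F) (f : V -> U) (v : V) :
  linear f ->
  f v = \sum_i coord (vbasis {:V}) i v *: f (vbasis {:V})`_i.
Proof.
move=> fL; pose fM := GRing.isLinear.Build _ _ _ _ _ fL.
pose f' : {linear V -> U} := HB.pack f fM.
rewrite -[f]/(f' : V -> U) {1}(coord_vbasis (memvf v)) linear_sum.
by apply: eq_bigr => i _; rewrite linearZ.
Qed.

Lemma tens_lift_tens (F : fieldType) (V U : vectType F)
    (phi : V -> V -> V -> V -> U) (a b c d : V) :
  linear4 phi -> tens_lift phi (a ⊗ b) (c ⊗ d) = phi a b c d.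
Proof.
case=> La Lb Lc Ld; rewrite (linear_coord_sum a (La b c d)) /tens_lift.
apply: eq_bigr => i _; rewrite (linear_coord_sum b (Lb _ c d)) scaler_sumr.
apply: eq_bigr => j _; rewrite (linear_coord_sum c (Lc _ _ d)) !scaler_sumr.
apply: eq_bigr => k _; rewrite (linear_coord_sum d (Ld _ _ _)) !scaler_sumr.
by apply: eq_bigr => l _; rewrite !mxE !scalerA !mulrA.
Qed.

Lemma tens_linearl (F : fieldType) (V W : vectType F) (w : W) :
  linear (fun v : V => v ⊗ w).
Proof. by move=> k u v; apply/matrixP => i j; rewrite !mxE linearP mulrDl mulrA. Qed.

Lemma tens_linearr (F : fieldType) (V W : vectType F) (v : V) :
  linear (fun w : W => v ⊗ w).
Proof.
by move=> k u w; apply/matrixP => i j; rewrite !mxE linearP mulrDr mulrCA.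
Qed.

Definition bracket12_13 (F : fieldType) (L : lieAlgType F) :
    tensor L L -> tensor L L -> tensor3 L :=
  tens_lift (fun a b c d => [Lie a, c] ⊗ b ⊗ d).
Definition bracket12_23 (F : fieldType) (L : lieAlgType F) :
    tensor L L -> tensor L L -> tensor3 L :=
  tens_lift (fun a b c d => a ⊗ [Lie b, c] ⊗ d).
Definition bracket13_23 (F : fieldType) (L : lieAlgType F) :
    tensor L L -> tensor L L -> tensor3 L :=
  tens_lift (fun a b c d => a ⊗ c ⊗ [Lie b, d]).

Lemma bracket12_13_tens (F : fieldType) (L : lieAlgType F) (a b c d : L) :
  bracket12_13 (a ⊗ b) (c ⊗ d) = [Lie a, c] ⊗ b ⊗ d.
Proof.
apply: tens_lift_tens; split=> >.
- by rewrite lie_linearl !tens_linearl.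
- by rewrite tens_linearr tens_linearl.
- by rewrite lie_linearr !tens_linearl.
- by rewrite tens_linearr.
Qed.

Lemma bracket12_23_tens (F : fieldType) (L : lieAlgType F) (a b c d : L) :
  bracket12_23 (a ⊗ b) (c ⊗ d) = a ⊗ [Lie b, c] ⊗ d.
Proof.
apply: tens_lift_tens; split=> >.
- by rewrite !tens_linearl.
- by rewrite lie_linearl tens_linearr tens_linearl.
- by rewrite lie_linearr tens_linearr tens_linearl.
- by rewrite tens_linearr.
Qed.

Lemma bracket13_23_tens (F : fieldType) (L : lieAlgType F) (a b c d : L) :
  bracket13_23 (a ⊗ b) (c ⊗ d) = a ⊗ c ⊗ [Lie b, d].
Proof.
apply: tens_lift_tens; split=> >.
- by rewrite !tens_linearl.
- by rewrite lie_linearl tens_linearr.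
- by rewrite tens_linearr tens_linearl.
- by rewrite lie_linearr tens_linearr.
Qed.

(* [r n k] is the coefficient of x^n y^k. *)
Definition biseries (V : Type) : Type := int -> nat -> V.

(* Membership in V((x))[[y]]. *)
Definition is_lps (V : zmodType) (r : biseries V) : Prop :=
  forall k : nat, exists N : int, forall n : int, n < N -> r n k = 0.

(* 1 / (x - y) = \sum_(k >= 0) x^(-k-1) y^k *)
Definition inv_x_sub_y (F : fieldType) : biseries F :=
  fun n k => (n == - k.+1%:Z)%:R.

(* s(y) Om / (x - y) + g(x, y), for g in V[[x, y]] given by its coefficients. *)
Definition pole_series (F : fieldType) (V : lmodType F) (Om : V) (s : fps F)
    (g : nat -> nat -> V) : biseries V :=
  fun n k =>
    (\sum_(l < k.+1) s l * inv_x_sub_y F n (k - l)%N) *: Om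
    + (if n is Posz m then g m k else 0).

Lemma pole_series_lps (F : fieldType) (V : lmodType F) (Om : V) (s : fps F)
    (g : nat -> nat -> V) : is_lps (pole_series Om s g).
Proof.
move=> k; exists (- k.+1%:Z) => -[m|m] // mk.
rewrite /pole_series addr0 big1 ?scale0r // => l _.
rewrite /inv_x_sub_y lt_eqF ?mulr0 //; apply: (lt_le_trans mk).
by rewrite lerN2 lez_nat ltnS leq_subr.
Qed.

(* Coefficients of x1^n x2^m x3^k, where n, m are in int and k in nat.  The sums
   over int and nat have finite support as soon as r is in V((x))[[y]]. *)
Definition cybe12_13 (F : fieldType) (L : lieAlgType F)
    (r : biseries (tensor L L)) (n m : int) (k : nat) : tensor3 L :=
  if m is Posz j then
    \sum_(i \in [set: int]) bracket12_13 (r i j) (r (n - i) k)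
  else 0.
Definition cybe12_23 (F : fieldType) (L : lieAlgType F)
    (r : biseries (tensor L L)) (n m : int) (k : nat) : tensor3 L :=
  \sum_(j \in [set: nat]) bracket12_23 (r n j) (r (m - j%:Z) k).
Definition cybe13_23 (F : fieldType) (L : lieAlgType F)
    (r : biseries (tensor L L)) (n m : int) (k : nat) : tensor3 L :=
  \sum_(j < k.+1) bracket13_23 (r n j) (r m (k - j)%N).

Definition CYBE (F : fieldType) (L : lieAlgType F)
    (r : biseries (tensor L L)) : Prop :=
  forall (n m : int) (k : nat),
    cybe12_13 r n m k + cybe12_23 r n m k + cybe13_23 r n m k = 0.

(* psi in x F[[x]]^* *)
Definition coord_change (F : fieldType) (psi : fps F) : Prop :=
  psi 0%N = 0 /\ psi 1%N != 0.

(* The coefficient of x^n in psi^m in F((x)), for psi in x F[[x]]^*: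
   psi^m = x^m u^m, where u = psi / x is a unit of F[[x]]. *)
Definition laurent_pow (F : fieldType) (psi : fps F) (m n : int) : F :=
  let u : fps F := fun i => psi i.+1 in
  if n - m is Posz j then (u ^ m) j else 0.

(* r(psi(x), psi(y)).  For r in V((x))[[y]] and psi in x F[[x]]^* the sum over
   int has finite support, and psi^k has no coefficient of degree l < k. *)
Definition subst_xy (F : fieldType) (V : lmodType F) (psi : fps F)
    (r : biseries V) : biseries V :=
  fun n l => \sum_(k < l.+1) \sum_(m \in [set: int])
    (laurent_pow psi m n * (psi ^+ k) l) *: r m k.

Definition zero_mult (F : fieldType) (f : fps F) (m : nat) : Prop :=
  (forall i, (i < m)%N -> f i = 0) /\ f m != 0.

(* xi r(psi(x), psi(y)) = t(y) Om / (x - y) + h(x, y) for some psi in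
   x F[[x]]^*, xi in F^* and h in V[[x, y]]. *)
Definition transforms_to (F : fieldType) (V : lmodType F) (Om : V)
    (r : biseries V) (t : fps F) : Prop :=
  exists (psi : fps F) (xi : F) (h : nat -> nat -> V),
    [/\ coord_change psi, xi != 0 &
      forall (n : int) (k : nat),
        xi *: subst_xy psi r n k = pole_series Om t h n k].

(* Main.v *)
(* Take brackets of adjacent tensor legs in the Yang-Baxter equation and restrict
   to the diagonals x_1 = x_2 and x_2 = x_3. Since the Casimir operator of the
   adjoint representation is 1, with h(x) the bracket of the legs of g(x, x) and
   Q = \sum [a, a'] ⊗ [b, b'] this yields
     s(x) dr/dx (x, z) = [h(x) ⊗ 1, r] + Q,
     s(z) dr/dz (x, z) = [1 ⊗ h(z), r] - Q.
   In the sum Q disappears, so s d/dx - ad h preserves the span W_k of the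
   coefficients of z^j for j <= k (with respect to the second leg) when s has a
   zero of multiplicity m >= 2. Hence s d/dx preserves the span of the Laurent
   series K(w, w') for w, w' in W_k, where K is the Killing form. This space is finite
   dimensional and, for k = m + 1, contains series of order -2 and -3. As
   s d/dx raises the order n of a series by exactly m - 1 unless n = 0, the order 0
   must be reached from both -2 and -3, so m - 1 divides 2 and 3; and if m = 2,
   then the space contains f = a x^-1 + ... with a != 0 and s f' constant, which
   forces s_3 = 0. The normal forms come from solving psi' t = xi s(psi). *)
Require Import Defs.
From HB Require Import structures.
From mathcomp Require Import all_boot all_order all_algebra.
From mathcomp Require Import boolp classical_sets functions cardinality fsbigop.
From mathcomp Require Import ring zify.
Set Implicit Arguments.
Unset Strict Implicit.
Unset Printing Implicit Defensive.
Import Order.TTheory GRing.Theory Num.Theory.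
Local Open Scope ring_scope.

(** * Formal power series *)

Section FormalPowerSeries.
Variable F : fieldType.
Implicit Types (f g h u : fps F) (n k : nat).

Lemma fpsM f g n : (f * g) n = \sum_(i < n.+1) f i * g (n - i)%N.
Proof. by []. Qed.

Lemma fps1E n : (1 : fps F) n = (n == 0%N)%:R.
Proof. by []. Qed.

Lemma fps_sumE (I : Type) (r : seq I) (P : pred I) (G : I -> fps F) n :
  (\sum_(i <- r | P i) G i) n = \sum_(i <- r | P i) G i n.
Proof. by elim/big_rec2: _ => // i x f _ <-. Qed.

Lemma fpsD f g n : (f + g) n = f n + g n.
Proof. by []. Qed.

Lemma fpsB f g n : (f - g) n = f n - g n.
Proof. by []. Qed.

Definition fpsC (a : F) : fps F := fun n => if n is 0 then a else 0.

Lemma fpsCM a f n : (fpsC a * f) n = a * f n.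
Proof.
rewrite fpsM big_ord_recl subn0 /= big1 ?addr0 // => i _.
by rewrite mul0r.
Qed.

Lemma fpsXM f n : (fpsX F * f) n = if n is n'.+1 then f n' else 0.
Proof.
case: n => [|n]; rewrite fpsM big_ord_recl /fpsX /= mul0r add0r.
  by rewrite big_ord0.
rewrite big_ord_recl /= mul1r subSS subn0 big1 ?addr0 // => i _.
by rewrite mul0r.
Qed.

Lemma fpsXnM k f n : (fpsX F ^+ k * f) n = if (k <= n)%N then f (n - k)%N else 0.
Proof.
elim: k n => [|k IH] n; first by rewrite expr0 mul1r subn0.
rewrite exprS -mulrA fpsXM; case: n => // n; rewrite IH ltnS subSS //.
Qed.

Definition fps_deriv f : fps F := fun n => n.+1%:R * f n.+1.
(** The operator x d/dx. It is diagonal on coefficients, and passing from f to x^(-c) f only shifts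
    its eigenvalues by -c. *)
Definition fps_euler f : fps F := fun n => n%:R * f n.

Lemma fps_eulerE f : fps_euler f = fpsX F * fps_deriv f.
Proof.
by apply/funext => -[|n]; rewrite fpsXM /fps_euler ?mul0r.
Qed.

Lemma fps_eulerM f g : fps_euler (f * g) = fps_euler f * g + f * fps_euler g.
Proof.
apply/funext => n; rewrite /fps_euler fpsM.
transitivity ((fps_euler f * g) n + (f * fps_euler g) n); last by [].
rewrite !fpsM -big_split mulr_sumr; apply: eq_bigr => i _ /=.
have -> : n%:R = i%:R + (n - i)%:R :> F.
  by rewrite -natrD subnKC // -ltnS.
rewrite /fps_euler; ring.
Qed.

Lemma fps_eulerD f g : fps_euler (f + g) = fps_euler f + fps_euler g.
Proof. by apply/funext => n; rewrite /fps_euler fpsD mulrDr. Qed.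

Lemma fps_euler1 : fps_euler 1 = 0.
Proof. by apply/funext => -[|n]; rewrite /fps_euler fps1E ?mul0r //= mulr0. Qed.

Lemma fps_eulerX u k : fps_euler (u ^+ k) = k%:R * (u ^+ k.-1 * fps_euler u).
Proof.
elim: k => [|k IH]; first by rewrite expr0 fps_euler1 mul0r.
rewrite exprS fps_eulerM IH /=; case: k {IH} => [|k].
  by rewrite expr0 mul0r mulr0 addr0 mulr1 !mul1r.
rewrite [in RHS]mulrSr exprS /=; ring.
Qed.

Lemma fps_natrE k n : (k%:R : fps F) n = if n is 0 then k%:R else 0.
Proof.
elim: k n => [|k IH] [|n]; rewrite ?mulr0n // mulrSr.
  by rewrite [LHS](_ : _ = (k%:R : fps F) 0%N + 1) // IH -mulrSr.
by rewrite [LHS](_ : _ = (k%:R : fps F) n.+1 + 0) // IH addr0.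
Qed.

Lemma fps_natM k f n : (k%:R * f) n = k%:R * f n.
Proof.
have -> : k%:R = fpsC k%:R by apply/funext => m; rewrite fps_natrE.
exact: fpsCM.
Qed.

Lemma fps_expr_low f k n : f 0%N = 0 -> (n < k)%N -> (f ^+ k) n = 0.
Proof.
move=> f0; elim: k n => // k IH n nk; rewrite exprS fpsM big1 // => i _.
have [->|i0] := eqVneq (i : nat) 0%N; first by rewrite f0 mul0r.
by rewrite IH ?mulr0 //; move: (ltn_ord i) i0 nk; lia.
Qed.

Lemma fps_unit f : (f \is a GRing.unit) = (f 0%N != 0).
Proof. by []. Qed.

End FormalPowerSeries.

(** Here [g] enumerates a finite window that contains the support. The sums over [int] and [nat] in
    [CYBE] and [subst_xy] become finite through it. *)
Lemma fsbig_codom (V : nmodType) (I : choiceType) (f : I -> V) (T : finType)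
    (g : T -> I) : injective g -> (forall i, f i != 0 -> exists t, i = g t) ->
  \sum_(i \in [set: I]) f i = \sum_t f (g t).
Proof.
move=> g_inj fg; rewrite (@fsbigE _ _ _ _ _ (codom g)) //.
- rewrite (eq_bigl xpredT) => [|i]; last exact: in_setT.
  by rewrite big_map big_enum.
- by rewrite /codom map_inj_uniq ?enum_uniq.
- move=> i _; apply: contraNeq => /fg [t ->]; exact: codom_f.
Qed.

(** * Change of coordinate *)

Section FormalODE.
Variable F : fieldType.
Hypothesis charF0 : [pchar F] =i pred0.
Implicit Types (s t u psi : fps F) (n k : nat).

Lemma natrS_neq0 n : n.+1%:R != 0 :> F.
Proof. by have /pcharf0P -> := charF0. Qed.

(** Degree n of [G u] depends only on the degrees up to n of [u]. So u' = G u is a recursion for the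
    coefficients, solvable because n + 1 is invertible. *)
Lemma fps_ode (G : fps F -> fps F) (a : F) :
    (forall n u v, (forall i, (i <= n)%N -> u i = v i) -> G u n = G v n) ->
  exists u : fps F, u 0%N = a /\ fps_deriv u = G u.
Proof.
move=> Gcausal.
(* The coefficient of degree n is stable after n + 1 iterations from 0, so the diagonal of the
   iterates is the fixed point. *)
pose step u : fps F := fun n => if n is m.+1 then m.+1%:R^-1 * G u m else a.
pose u : fps F := fun n => iter n.+1 step 0 n.
have stable n : forall k, (n < k)%N -> iter k step 0 n = u n.
  elim/ltn_ind: n => -[|n] IH [|k] // nk.
  rewrite [in RHS]/u !iterS; congr (_ * _); apply: Gcausal => i ni.
  by rewrite -iterS (IH i ni k (leq_ltn_trans ni nk)) (IH i ni n.+1).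
exists u; split=> //; apply/funext => n.
transitivity (G (iter n.+1 step 0) n).
  by rewrite /fps_deriv /u iterS mulVKf ?natrS_neq0.
by apply: Gcausal => i ni; rewrite stable.
Qed.

Lemma fps_derivXM u : fps_deriv (fpsX F * u) = u + fps_euler u.
Proof.
apply/funext => n; rewrite /fps_deriv fpsXM -[n.+1]addn1 natrD mulrDl mul1r.
by rewrite addrC.
Qed.

(* The residue of [psi^(i-j-1) psi'] is 1 if [i = j], and 0 otherwise. *)
Lemma residue_expr u i j : u 0%N != 0 ->
  let psi := fpsX F * u in
  (psi ^+ i * fps_deriv psi * u ^- j.+1) j = (i == j)%:R.
Proof.
move=> u0 psi; rewrite -fps_unit in u0; rewrite /psi fps_derivXM exprMn -!mulrA fpsXnM.
case: ltngtP => // [ij|<-]; last first.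
  rewrite subnn mulrA mulrDr -exprSr mulrDl divrr ?unitrX //.
  rewrite [LHS](_ : _ = (1 : fps F) 0%N + (u ^+ i * fps_euler u / u ^+ i.+1) 0%N) //.
  rewrite mulrAC fpsM big_ord1 /fps_euler mul0r mulr0 addr0.
  by [].
(* For i < j the form is exact. With v = u^-1, the coefficient of degree d of v^d + v^(d+1) x u' is
   wanted. Comparing degree d in x (v^d)' = - d v^(d+1) x u' and dividing by d shows that it is
   0. *)
set d := (j - i)%N; have d0 : (0 < d)%N by rewrite subn_gt0.
have -> : u ^+ i * ((u + fps_euler u) * u ^- j.+1) =
          (u^-1) ^+ d + (u^-1) ^+ d.+1 * fps_euler u.
  have -> : u ^- j.+1 = (u^-1) ^+ d.+1 * u ^- i.
    by rewrite -!exprVn -exprD; congr (_ ^+ _); rewrite /d; lia.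
  have -> : u ^+ i * ((u + fps_euler u) * (u^-1 ^+ d.+1 * u ^- i)) =
    (u ^+ i * u ^- i) * ((u * u^-1) * u^-1 ^+ d + u^-1 ^+ d.+1 * fps_euler u).
    by rewrite exprS; ring.
  by rewrite !divrr ?unitrX // !mul1r.
have eV : fps_euler u^-1 = - (u^-1 ^+ 2 * fps_euler u).
  have := fps_eulerM u u^-1; rewrite divrr // fps_euler1 => /esym/eqP.
  rewrite addrC addr_eq0 => /eqP /(congr1 (fun v => u^-1 * v)).
  by rewrite mulrA mulVr // mul1r => ->; ring.
have := fps_eulerX u^-1 d; rewrite eV.
have -> : d%:R * (u^-1 ^+ d.-1 * - (u^-1 ^+ 2 * fps_euler u)) =
   d%:R * (- (u^-1 ^+ d.+1 * fps_euler u)).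
  have -> : d.+1 = (d.-1 + 2)%N by lia.
  by rewrite exprD; ring.
move=> /(congr1 (fun v : fps F => v d)); rewrite fps_natM {1}/fps_euler.
have dF : d%:R != 0 :> F by rewrite -(prednK d0) natrS_neq0.
move=> /(mulfI dF) e.
rewrite [LHS](_ : _ = (u^-1 ^+ d) d + (u^-1 ^+ d.+1 * fps_euler u) d) // e.
exact: addNr.
Qed.

(** With D = s(psi), this is psi^i s(psi) = (y^i s)(psi). The sums over k stop at the degree in
    question because psi^k has no term below degree k. *)
Lemma fps_comp_expr s D psi i l : psi 0%N = 0 ->
    (forall n, D n = \sum_(k < n.+1) s k * (psi ^+ k) n) ->
  (psi ^+ i * D) l =
  \sum_(k < l.+1) (if (i <= k)%N then s (k - i)%N else 0) * (psi ^+ k) l.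
Proof.
move=> psi0 DE.
have -> : (psi ^+ i * D) l = (psi ^+ i * \sum_(k < l.+1) fpsC (s k) * psi ^+ k) l.
  rewrite !fpsM; apply: eq_bigr => j _; congr (_ * _).
  rewrite DE fps_sumE (big_ord_widen l.+1 (fun k => s k * (psi ^+ k) (l - j)%N)) //.
    rewrite big_mkcond; apply: eq_bigr => k _; rewrite fpsCM.
    by case: ifP => // /negbT; rewrite -leqNgt => lk; rewrite fps_expr_low ?mulr0.
  by rewrite ltnS leq_subr.
rewrite mulr_sumr fps_sumE.
transitivity (\sum_(0 <= k < l.+1) s k * (psi ^+ (k + i)) l).
  rewrite big_mkord; apply: eq_bigr => k _.
  by rewrite mulrCA fpsCM -exprD addnC.
transitivity (\sum_(0 <= k < l.+1 + i) (if (i <= k)%N then s (k - i)%N else 0) * (psi ^+ k) l).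
  rewrite [RHS](big_cat_nat (n := i)) ?leq_addl //= [X in X + _]big1_seq ?add0r; last first.
    by move=> k; rewrite mem_index_iota => /andP[_ /= ki]; rewrite leqNgt ki mul0r.
  rewrite -{2}[i]add0n big_addn addnK; apply: eq_bigr => k _.
  by rewrite leq_addl addnK.
rewrite [LHS](big_cat_nat (n := l.+1)) ?leq_addr //= [X in _ + X]big1_seq ?addr0 ?big_mkord //.
move=> k; rewrite mem_index_iota => /andP[_ /andP[lk _]].
by rewrite (fps_expr_low psi0 lk) mulr0.
Qed.

End FormalODE.

(** * Substitution into a series with a pole on the diagonal *)

Section PoleSeries.
Variables (F : fieldType) (V : lmodType F) (Om : V).
Implicit Types (s t psi : fps F) (g : nat -> nat -> V).

Lemma pole_series_pos s g i k : pole_series Om s g (Posz i) k = g i k.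
Proof.
rewrite /pole_series big1 ?scale0r ?add0r // => l _.
by rewrite /inv_x_sub_y mulr0.
Qed.

(** [Negz i] is -(i+1), and x^(-i-1) occurs in 1 / (x - y) only next to y^i. *)
Lemma pole_series_neg s g i k :
  pole_series Om s g (Negz i) k = (if (i <= k)%N then s (k - i)%N else 0) *: Om.
Proof.
rewrite /pole_series addr0; congr (_ *: _).
transitivity (\sum_(l < k.+1) s l * (i == k - l)%N%:R); first by [].
case: ifP => [ik|/negbT]; last first.
  rewrite -ltnNge => ki; rewrite big1 // => l _.
  by rewrite (_ : (_ == _) = false) ?mulr0 //; apply/eqP; lia.
have lt : (k - i < k.+1)%N by rewrite ltnS leq_subr.
rewrite (bigD1 (Ordinal lt)) //= subKn // eqxx mulr1 big1 ?addr0 // => l.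
move=> /eqP lne; rewrite (_ : (_ == _) = false) ?mulr0 //.
apply/eqP => il; apply: lne; apply: val_inj => /=; have := ltn_ord l; lia.
Qed.

Lemma laurent_pow_neg psi i p :
  laurent_pow psi (Negz i) (Negz p) =
  let u : fps F := fun i => psi i.+1 in
  if (p <= i)%N then (u ^- i.+1) (i - p)%N else 0.
Proof.
rewrite /laurent_pow.
have -> : Negz p - Negz i = i%:Z - p%:Z by lia.
case: leqP => pi; first by rewrite subzn.
by rewrite -opprB subzn ?(ltnW pi) //; case: (p - i)%N (subn_gt0 i p) => [|n] //; rewrite pi.
Qed.

Lemma laurent_pow_npos psi (i p : nat) : laurent_pow psi i (Negz p) = 0.
Proof.
rewrite /laurent_pow (_ : Negz p - i%:Z = Negz (p + i)) //; lia.
Qed.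

Hypothesis charF0 : [pchar F] =i pred0.

(** The last hypothesis is psi' t = xi s(psi). It suffices because psi'(y) / (psi(x) - psi(y)) and 1
    / (x - y) have the same negative powers of x, by the residue formula. *)
Lemma transforms_to_pole_series s t g psi (xi : F) :
    coord_change psi -> xi != 0 ->
    (forall n, (fps_deriv psi * t) n = xi * \sum_(k < n.+1) s k * (psi ^+ k) n) ->
  transforms_to Om (pole_series Om s g) t.
Proof.
move=> [psi0 psi1] xi0 ode.
set r := pole_series Om s g.
(* In degrees n >= 0 in x the series [h] is taken to be the left side, so only the principal part in
   x remains to be compared. *)
exists psi, xi, (fun n k => xi *: subst_xy psi r n k); split=> // -[p|p] l.
  by rewrite pole_series_pos.
rewrite pole_series_neg /subst_xy.
pose u : fps F := fun i => psi i.+1.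
have psiE : psi = fpsX F * u by apply/funext => -[|n]; rewrite fpsXM.
(* [A] holds the coefficients of psi^i psi', and [B] the principal parts of psi^(-i-1). Residues
   give A B = 1; the expansion of 1 / (x - y) is B A = 1, which follows as the matrices are
   square. *)
pose A := \matrix_(i < l.+1, q < l.+1) (psi ^+ i * fps_deriv psi) q.
pose B := \matrix_(p < l.+1, i < l.+1)
  (if (p <= i)%N then (u ^- i.+1) (i - p)%N else 0).
have AB : A *m B = 1%:M.
  apply/matrixP => i j; rewrite !mxE [RHS](_ : _ = (i == j :> nat)%:R) //.
  rewrite -(@residue_expr _ charF0 u) // -psiE fpsM.
  rewrite (big_ord_widen l.+1
    (fun q => (psi ^+ i * fps_deriv psi) q * (u ^- j.+1) (j - q)%N)) //.
  rewrite [RHS]big_mkcond; apply: eq_bigr => q _; rewrite !mxE ltnS.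
  by case: ifP => //; rewrite mulr0.
have BA := mulmx1C AB.
(* Summing over k first produces psi^i xi s(psi), which the hypothesis replaces by psi^i psi' t. *)
transitivity ((\sum_(i < l.+1) laurent_pow psi (Negz i) (Negz p) *
   (psi ^+ i * (fps_deriv psi * t)) l) *: Om).
  under [in RHS]eq_bigr => i _.
    rewrite (@fps_comp_expr _ (fun k => xi * s k)) //; last first.
      by move=> n; rewrite ode mulr_sumr; apply: eq_bigr => k _; rewrite mulrA.
    rewrite mulr_sumr; over.
  rewrite exchange_big scaler_suml scaler_sumr; apply: eq_bigr => k _.
  (* Nonnegative powers of x contribute no negative ones after substitution, and the pole of the
     coefficient of y^k has order at most k + 1. *)
  rewrite (@fsbig_codom _ _ _ _ (fun i : 'I_k.+1 => Negz i)); last 2 first.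
  - by move=> i j [] /val_inj.
  - case=> [i|i]; first by rewrite laurent_pow_npos mul0r scale0r eqxx.
    rewrite /r pole_series_neg; case: leqP => ik; last by rewrite scale0r scaler0 eqxx.
    by move=> _; exists (Ordinal (ik : (i < k.+1)%N)).
  rewrite scaler_sumr scaler_suml.
  pose Y i : V := (laurent_pow psi (Negz i) (Negz p) *
   ((if (i <= k)%N then xi * s (k - i)%N else 0) * (psi ^+ k) l)) *: Om.
  rewrite -[RHS](big_mkord xpredT Y) [RHS](big_cat_nat (n := k.+1)) //= big_mkord.
  rewrite [X in _ + X]big1_seq ?addr0; last first.
    move=> i; rewrite mem_index_iota => /andP[_ /andP[ki _]].
    by rewrite /Y leqNgt ki mul0r mulr0 scale0r.
  apply: eq_bigr => i _; rewrite /r pole_series_neg /Y -(ltnS i) ltn_ord !scalerA.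
  by congr (_ *: _); ring.
congr (_ *: _).
(* For p > l both sides are 0. Otherwise row p of B A = 1 extracts t_(l-p). *)
case: leqP => pl; last first.
  rewrite big1 // => i _; rewrite laurent_pow_neg leqNgt.
  by rewrite (leq_trans (ltn_ord i) pl) mul0r.
have pl' : (p < l.+1)%N by [].
have BAp q : \sum_i B (Ordinal pl') i * A i q = (p == q :> nat)%:R.
  by move/matrixP: BA => /(_ (Ordinal pl') q); rewrite !mxE.
under eq_bigr => i _.
  rewrite mulrA fpsM mulr_sumr.
  under eq_bigr => q _ do rewrite mulrA.
  over.
rewrite exchange_big /=.
rewrite (bigD1 (Ordinal pl')) //= [X in _ + X]big1 ?addr0; last first.
  move=> q qp; rewrite -mulr_suml.
  have pq : (p == q :> nat) = false.
    by apply: contraNF qp => /eqP e; apply/eqP/val_inj.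
  have := BAp q; rewrite pq => e.
  rewrite [X in X * _](_ : _ = 0) ?mul0r // -[RHS]e.
  by apply: eq_bigr => i _; rewrite !mxE laurent_pow_neg.
rewrite -mulr_suml; have := BAp (Ordinal pl'); rewrite eqxx => e.
rewrite [X in X * _](_ : _ = 1) ?mul1r // -[RHS]e.
by apply: eq_bigr => i _; rewrite !mxE laurent_pow_neg.
Qed.

End PoleSeries.

(** * Normal forms of s *)

Section NormalForms.
Variable F : fieldType.
Hypothesis charF0 : [pchar F] =i pred0.
Implicit Types (s u v psi : fps F) (n k : nat).

Lemma fps_expr_causal n k u v : (forall i, (i <= n)%N -> u i = v i) ->
  (u ^+ k) n = (v ^+ k) n.
Proof.
elim: k n => [|k IH] n uv; first by rewrite !expr0.
rewrite !exprS !fpsM; apply: eq_bigr => i _.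
have i_n := ltnSE (ltn_ord i).
by rewrite uv // IH // => j jn; apply: uv; apply: leq_trans jn (leq_subr _ _).
Qed.

(** The equation psi' = s(psi), psi(0) = 0 is regular, and psi_1 = s_0. *)
Lemma normal_form_mult0 s : s 0%N != 0 ->
  exists psi, coord_change psi /\
  forall n, (fps_deriv psi * 1) n = 1 * \sum_(k < n.+1) s k * (psi ^+ k) n.
Proof.
move=> s0.
have [|psi [psi0 dpsi]] :=
    fps_ode charF0 (G := fun psi n => \sum_(k < n.+1) s k * (psi ^+ k) n) 0.
  by move=> n u v uv; apply: eq_bigr => k _; rewrite (fps_expr_causal k uv).
exists psi; split; last by move=> n; rewrite mulr1 mul1r dpsi.
split=> //; have := congr1 (fun f : fps F => f 0%N) dpsi.
by rewrite /fps_deriv mul1r big_ord1 expr0 fps1E mulr1 => ->.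
Qed.

(** Put psi = x u. With xi = 1 / s_1 the terms x u on both sides of x psi' = xi s(psi) cancel, and
    division by x^2 leaves the regular equation u' = xi sum_k s_(k+2) x^k u^(k+2). *)
Lemma normal_form_mult1 s : s 0%N = 0 -> s 1%N != 0 ->
  exists psi, coord_change psi /\
  forall n, (fps_deriv psi * fpsX F) n
            = (s 1%N)^-1 * \sum_(k < n.+1) s k * (psi ^+ k) n.
Proof.
move=> s0 s1; set xi := (s 1%N)^-1.
have [|u [u0 du]] := fps_ode charF0
    (G := fun u n => xi * \sum_(k < n.+1) s k.+2 * (u ^+ k.+2) (n - k)%N) 1.
  move=> n u v uv; congr (_ * _); apply: eq_bigr => k _; congr (_ * _).
  by apply: fps_expr_causal => i ik; apply: uv; apply: leq_trans ik (leq_subr _ _).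
exists (fpsX F * u); split=> [|n].
  by split; rewrite fpsXM // u0 oner_neq0.
rewrite mulrC fpsXM fps_derivXM fps_eulerE; case: n => [|n].
  by rewrite big_ord1 s0 mul0r mulr0.
rewrite 2!big_ord_recl /bump /= s0 mul0r add0r mulrDr expr1 fpsXM mulrA mulVf // mul1r.
rewrite [LHS](_ : _ = u n + (fpsX F * fps_deriv u) n) //; congr (_ + _).
rewrite fpsXM; case: n => [|n]; first by rewrite big_ord0 mulr0.
rewrite du; congr (_ * _); apply: eq_bigr => k _.
by rewrite exprMn fpsXnM /bump !leq0n !add1n !ltnS leq_ord !subSS.
Qed.

(** Put psi = x u and u = 1 + x y. As s_3 = 0, x^2 psi' = xi s(psi) divided by x^4 becomes the
    regular equation y' = y^2 + xi sum_k s_(k+4) x^k u^(k+4). A term with s_3 would leave a pole in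
    it. *)
Lemma normal_form_mult2 s :
    s 0%N = 0 -> s 1%N = 0 -> s 2%N != 0 -> s 3%N = 0 ->
  exists psi, coord_change psi /\
  forall n, (fps_deriv psi * fpsX F ^+ 2) n
            = (s 2%N)^-1 * \sum_(k < n.+1) s k * (psi ^+ k) n.
Proof.
move=> s0 s1 s2 s3; set xi := (s 2%N)^-1.
have [|y [_ dy]] := fps_ode charF0 (G := fun y n => (y ^+ 2) n +
    xi * \sum_(k < n.+1) s k.+4 * ((1 + fpsX F * y) ^+ k.+4) (n - k)%N) 0.
  move=> n u v uv; rewrite (fps_expr_causal 2 uv); congr (_ + _ * _).
  apply: eq_bigr => k _; congr (_ * _); apply: fps_expr_causal => i ik.
  rewrite [LHS](_ : _ = (1 : fps F) i + (fpsX F * u) i) //.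
  rewrite [RHS](_ : _ = (1 : fps F) i + (fpsX F * v) i) // !fpsXM.
  by case: i ik => // i ik; rewrite uv //; move: ik (leq_subr k n); lia.
set u := 1 + fpsX F * y in dy.
have u0 : u 0%N = 1.
  by rewrite [u 0%N](_ : _ = (1 : fps F) 0%N + (fpsX F * y) 0%N) // fpsXM addr0.
exists (fpsX F * u); split=> [|n].
  by split; rewrite fpsXM // u0 oner_neq0.
rewrite mulrC fpsXnM fps_derivXM; case: n => [|[|n]].
- by rewrite big_ord1 s0 mul0r mulr0.
- by rewrite !big_ord_recr big_ord0 /= s0 s1 !mul0r !addr0 mulr0.
rewrite 3!big_ord_recl /bump /= s0 s1 !mul0r !add0r mulrDr mulrA mulVf // mul1r.
rewrite exprMn fpsXnM /= !subSS !subn0.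
(* Both sides are 1 + 2 x y + x^2 y'. *)
have -> : u + fps_euler u = u ^+ 2 + fpsX F ^+ 2 * (fps_deriv y - y ^+ 2).
  have -> : fps_euler u = fpsX F * (y + fpsX F * fps_deriv y).
    by rewrite /u fps_eulerD fps_euler1 add0r fps_eulerE fps_derivXM fps_eulerE.
  by rewrite /u; ring.
rewrite [LHS](_ : _ = (u ^+ 2) n + (fpsX F ^+ 2 * (fps_deriv y - y ^+ 2)) n) //.
congr (_ + _); rewrite fpsXnM; case: n => [|[|n]]; rewrite ?big_ord0 ?mulr0 //.
  by rewrite big_ord_recl big_ord0 s3 mul0r addr0 mulr0.
rewrite [LHS](_ : _ = fps_deriv y n - (y ^+ 2) n) ?subSS ?subn0 // dy addrC addKr.
rewrite [in RHS]big_ord_recl s3 mul0r add0r; congr (_ * _); apply: eq_bigr => k _.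
by rewrite exprMn fpsXnM /bump !leq0n !add1n !ltnS leq_ord !subSS.
Qed.

End NormalForms.

(** * Killing form and tensors *)

HB.instance Definition _ (F : fieldType) (L : lieAlgType F) (x : L) :=
  GRing.isLinear.Build F L L _ (lie x) (lie_linearr x).

Section LieBracket.
Variables (F : fieldType) (L : lieAlgType F).
Implicit Types x y z : L.

Lemma lieDl z x y : [Lie x + y, z] = [Lie x, z] + [Lie y, z].
Proof. by have := lie_linearl z 1 x y; rewrite !scale1r. Qed.

Lemma lieC x y : [Lie x, y] = - [Lie y, x].
Proof.
apply/eqP; rewrite -addr_eq0; apply/eqP.
by have := liexx (x + y); rewrite lieDl !linearD /= !liexx add0r addr0.
Qed.

Lemma lieZl a x y : [Lie a *: x, y] = a *: [Lie x, y].
Proof. by rewrite lieC linearZ -scalerN -lieC. Qed.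

Lemma lie_suml (I : Type) (r : seq I) (P : pred I) (G : I -> L) x :
  [Lie \sum_(i <- r | P i) G i, x] = \sum_(i <- r | P i) [Lie G i, x].
Proof.
rewrite lieC linear_sum -sumrN; apply: eq_bigr => i _.
by rewrite [RHS]lieC.
Qed.

Lemma lie_lie x y z : [Lie [Lie x, y], z] = [Lie x, [Lie y, z]] - [Lie y, [Lie x, z]].
Proof.
have := lie_jacobi x y z; rewrite [ [Lie z, x] ]lieC linearN /= [ [Lie z, _] ]lieC.
by move=> /eqP; rewrite subr_eq0 => /eqP <-.
Qed.

End LieBracket.

Section Trace.
Variables (F : fieldType) (V : vectType F).
Local Notation v := (vbasis {:V}).

Definition endo_trace (f : V -> V) : F := \sum_(i < \dim {:V}) coord v i (f v`_i).

Lemma endo_traceC (f g : {linear V -> V}) :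
  endo_trace (f \o g) = endo_trace (g \o f).
Proof.
have expand (f1 g1 : {linear V -> V}) : endo_trace (f1 \o g1) =
    \sum_(i < \dim {:V}) \sum_(j < \dim {:V}) coord v j (g1 v`_i) * coord v i (f1 v`_j).
  apply: eq_bigr => i _ /=; rewrite {1}(coord_vbasis (memvf (g1 v`_i))).
  by rewrite !linear_sum; apply: eq_bigr => j _; rewrite !linearZ.
rewrite !expand exchange_big; apply: eq_bigr => i _; apply: eq_bigr => j _.
exact: mulrC.
Qed.

End Trace.

Section Killing.
Variables (F : fieldType) (L : lieAlgType F).
Implicit Types x y z : L.

Lemma killing_trace x y : killing x y = endo_trace (lie x \o lie y).
Proof. exact: killingE. Qed.

Lemma killing_is_linear x : scalar (killing x).
Proof.
move=> a y z; rewrite !killing_trace mulr_sumr -big_split.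
by apply: eq_bigr => i _ /=; rewrite lieDl lieZl !linearD !linearZ.
Qed.

HB.instance Definition _ x :=
  GRing.isLinear.Build F L F *%R (killing x) (killing_is_linear x).

Lemma killingC x y : killing x y = killing y x.
Proof. by rewrite !killing_trace endo_traceC. Qed.

Lemma killingNr x y : killing x (- y) = - killing x y.
Proof. by rewrite -scaleN1r linearZ; exact: mulN1r. Qed.

(** Both sides are differences of traces of triple products of adjoint operators, which agree by
    cyclicity of the trace. *)
Lemma killing_lie x y z : killing [Lie x, y] z = killing x [Lie y, z].
Proof.
rewrite !killing_trace.
have -> : endo_trace (lie [Lie x, y] \o lie z) =
  endo_trace ((lie x \o lie y) \o lie z) - endo_trace (lie y \o (lie x \o lie z)).
  by rewrite /endo_trace -sumrB; apply: eq_bigr => i _ /=; rewrite lie_lie linearB.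
have -> : endo_trace (lie x \o lie [Lie y, z]) =
  endo_trace ((lie x \o lie y) \o lie z) - endo_trace ((lie x \o lie z) \o lie y).
  by rewrite /endo_trace -sumrB; apply: eq_bigr => i _ /=; rewrite lie_lie !linearB.
by rewrite [X in _ - X]endo_traceC.
Qed.

Variables (e : (\dim {:L}).-tuple L).
Hypotheses (basis_e : basis_of {:L} e) (orthonormal_e : killing_orthonormal e).

Lemma killing_expand x : x = \sum_(i < \dim {:L}) killing e`_i x *: e`_i.
Proof.
have {1}-> := coord_basis basis_e (memvf x); apply: eq_bigr => i _; congr (_ *: _).
rewrite [in RHS](coord_basis basis_e (memvf x)) linear_sum (bigD1 i) //=.
rewrite big1 ?addr0 => [|j ji]; rewrite linearZ /= orthonormal_e.
  by rewrite eqxx; rewrite mulr1.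
by rewrite eq_sym (negPf ji) mulr0.
Qed.

Lemma killing_inj x y : (forall i : 'I_(\dim {:L}), killing e`_i x = killing e`_i y) -> x = y.
Proof.
move=> xy; rewrite (killing_expand x) [RHS]killing_expand.
by apply: eq_bigr => i _; rewrite xy.
Qed.

(** Expanding [vbasis] in the basis [e], or the images of [e] in [vbasis], gives the same double
    sum. *)
Lemma endo_trace_killing (f : {linear L -> L}) :
  endo_trace f = \sum_(i < \dim {:L}) killing e`_i (f e`_i).
Proof.
have eE (i : 'I_(\dim {:L})) : f e`_i =
    \sum_(j < \dim {:L}) coord (vbasis {:L}) j (f e`_i) *: (vbasis {:L})`_j.
  exact: coord_vbasis (memvf _).
transitivity (\sum_(j < \dim {:L}) \sum_(i < \dim {:L})
    killing e`_i (vbasis {:L})`_j * coord (vbasis {:L}) j (f e`_i)).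
  apply: eq_bigr => j _; rewrite {1}(killing_expand (vbasis {:L})`_j).
  by rewrite !linear_sum; apply: eq_bigr => i _; rewrite !linearZ.
rewrite exchange_big; apply: eq_bigr => i _; rewrite [in RHS]eE linear_sum.
by apply: eq_bigr => j _; rewrite linearZ mulrC.
Qed.

(* The Casimir operator of the adjoint representation is the identity, since
   its matrix coefficients are the values of the Killing form. *)
Lemma casimir_adjoint x : \sum_(i < \dim {:L}) [Lie e`_i, [Lie e`_i, x]] = x.
Proof.
apply: killing_inj => j; rewrite linear_sum [RHS]killing_trace.
rewrite (endo_trace_killing (lie e`_j \o lie x)); apply: eq_bigr => i _ /=.
rewrite -[RHS]killing_lie (lieC e`_i e`_j) (lieC x) killingNr (killingC (- _)) killingNr.
by rewrite opprK (killingC _ [Lie e`_j, _]) killing_lie.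
Qed.

End Killing.

Section TensorLift.
Variables (F : fieldType) (U V W : vectType F).
Implicit Types phi psi : V -> V -> V -> V -> U.

Lemma tens_lift_linearl phi S : linear (fun T : tensor V V => tens_lift phi T S).
Proof.
move=> a T T'; rewrite scaler_sumr -big_split; apply: eq_bigr => i _.
rewrite scaler_sumr -big_split; apply: eq_bigr => j _.
rewrite scaler_sumr -big_split; apply: eq_bigr => k _.
rewrite scaler_sumr -big_split; apply: eq_bigr => l _.
by rewrite !mxE mulrDl scalerDl scalerA mulrA.
Qed.

Lemma tens_lift_linearr phi (T : tensor V V) : linear (tens_lift phi T).
Proof.
move=> a S S'; rewrite scaler_sumr -big_split; apply: eq_bigr => i _.
rewrite scaler_sumr -big_split; apply: eq_bigr => j _.
rewrite scaler_sumr -big_split; apply: eq_bigr => k _.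
rewrite scaler_sumr -big_split; apply: eq_bigr => l _.
by rewrite !mxE mulrDr scalerDl scalerA mulrCA.
Qed.

HB.instance Definition _ phi T :=
  GRing.isLinear.Build F (tensor V V) U _ (tens_lift phi T) (tens_lift_linearr phi T).

(** The linear map on V ⊗ W induced by [phi] when [phi] is bilinear; see [tens_elim_tens]. *)
Definition tens_elim (phi : V -> W -> U) (T : tensor V W) : U :=
  \sum_i \sum_j T i j *: phi (vbasis {:V})`_i (vbasis {:W})`_j.

Lemma tens_elim_linear (phi : V -> W -> U) : linear (tens_elim phi).
Proof.
move=> a T S; rewrite scaler_sumr -big_split; apply: eq_bigr => i _.
rewrite scaler_sumr -big_split; apply: eq_bigr => j _.
by rewrite !mxE scalerDl scalerA.
Qed.

HB.instance Definition _ (phi : V -> W -> U) :=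
  GRing.isLinear.Build F (tensor V W) U _ (tens_elim phi) (tens_elim_linear phi).

Lemma tens_elim_tens (phi : V -> W -> U) v w :
  (forall w, linear (phi^~ w)) -> (forall v, linear (phi v)) ->
  tens_elim phi (v ⊗ w) = phi v w.
Proof.
move=> phil phir; rewrite (linear_coord_sum v (phil w)); apply: eq_bigr => i _.
rewrite (linear_coord_sum w (phir _)) scaler_sumr; apply: eq_bigr => j _.
by rewrite mxE scalerA.
Qed.

End TensorLift.

Lemma tensorE (F : fieldType) (V W : vectType F) (T : tensor V W) :
  T = tens_elim (fun v w => v ⊗ w) T.
Proof.
apply/matrixP => i j; rewrite !summxE (bigD1 i) //= summxE (bigD1 j) //= !mxE.
rewrite !(coord_free _ _ (basis_free (vbasisP _))) !eqxx !mulr1.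
rewrite !big1 ?addr0 // => [k ki|k kj].
  rewrite summxE big1 // => l _; rewrite !mxE.
  by rewrite !(coord_free _ _ (basis_free (vbasisP _))) ?[i == k]eq_sym (negPf ki) mul0r mulr0.
rewrite !mxE.
by rewrite !(coord_free _ _ (basis_free (vbasisP _))) ?[j == k]eq_sym (negPf kj) !mulr0.
Qed.


Definition bilinear_on (F : fieldType) (V W U : lmodType F) (B : V -> W -> U) : Prop :=
  (forall w, linear (B^~ w)) /\ (forall v, linear (B v)).

Lemma lie_bilinear (F : fieldType) (L : lieAlgType F) : bilinear_on (@lie F L).
Proof. by split=> ?; [exact: lie_linearl | exact: lie_linearr]. Qed.

Lemma linear_tens_sum (F : fieldType) (V W U : vectType F) (f : tensor V W -> U)
    (T : tensor V W) : linear f ->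
  f T = tens_elim (fun v w => f (v ⊗ w)) T.
Proof.
move=> fL; pose fM := GRing.isLinear.Build _ _ _ _ _ fL.
pose f' : {linear tensor V W -> U} := HB.pack f fM.
rewrite -[f]/(f' : _ -> _) {1}(tensorE T) linear_sum.
apply: eq_bigr => i _; rewrite linear_sum.
by apply: eq_bigr => j _; rewrite linearZ.
Qed.

Lemma bilinear_tens_ext (F : fieldType) (V W V' W' U : vectType F)
    (B C : tensor V W -> tensor V' W' -> U) :
  bilinear_on B -> bilinear_on C ->
  (forall a b c d, B (a ⊗ b) (c ⊗ d) = C (a ⊗ b) (c ⊗ d)) ->
  forall T S, B T S = C T S.
Proof.
move=> [Bl Br] [Cl Cr] BC T S.
rewrite (linear_tens_sum T (Bl S)) (linear_tens_sum T (Cl S)).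
apply: eq_bigr => i _; apply: eq_bigr => j _; congr (_ *: _).
rewrite (linear_tens_sum S (Br _)) (linear_tens_sum S (Cr _)).
by apply: eq_bigr => k _; apply: eq_bigr => l _; rewrite BC.
Qed.

Section TensorArith.
Variables (F : fieldType) (V W : vectType F).
Implicit Types (v : V) (w : W).

Lemma tensDl v v' w : (v + v') ⊗ w = v ⊗ w + v' ⊗ w.
Proof. by have := tens_linearl w 1 v v'; rewrite !scale1r. Qed.

Lemma tensDr v w w' : v ⊗ (w + w') = v ⊗ w + v ⊗ w'.
Proof. by have := tens_linearr v 1 w w'; rewrite !scale1r. Qed.

Lemma tens0l w : (0 : V) ⊗ w = 0.
Proof. by apply/matrixP => i j; rewrite !mxE linear0 mul0r. Qed.

Lemma tens_suml (I : Type) (r : seq I) (P : pred I) (G : I -> V) w :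
  (\sum_(i <- r | P i) G i) ⊗ w = \sum_(i <- r | P i) G i ⊗ w.
Proof.
by elim/big_rec2: _ => [|i x y _ <-]; rewrite ?tensDl // tens0l.
Qed.

Lemma tens0r v : v ⊗ (0 : W) = 0.
Proof. by apply/matrixP => i j; rewrite !mxE linear0 mulr0. Qed.

Lemma tens_sumr (I : Type) (r : seq I) (P : pred I) (G : I -> W) v :
  v ⊗ (\sum_(i <- r | P i) G i) = \sum_(i <- r | P i) v ⊗ G i.
Proof.
by elim/big_rec2: _ => [|i x y _ <-]; rewrite ?tensDr // tens0r.
Qed.

Lemma tensNr v w : v ⊗ (- w) = - (v ⊗ w).
Proof. by apply/matrixP => i j; rewrite !mxE linearN mulrN. Qed.

End TensorArith.

(** * Contractions of adjacent tensor legs *)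

Section Legs.
Variables (F : fieldType) (L : lieAlgType F).
Implicit Types (a b c d h : L) (T S : tensor L L).

Definition tens_lie : tensor L L -> L := tens_elim (@lie F L).

Definition lie12 : tensor3 L -> tensor L L :=
  tens_elim (fun (t : tensor L L) c => tens_lie t ⊗ c).
Definition lie23 : tensor3 L -> tensor L L :=
  tens_elim (fun (t : tensor L L) c => tens_elim (fun a b => a ⊗ [Lie b, c]) t).

(** [ad1] brackets with h on the left and [ad2] on the right, so that [lie12_bracketD] and
    [lie23_bracketD] come out without signs. *)
Definition ad1 h : tensor L L -> tensor L L := tens_elim (fun a b => [Lie h, a] ⊗ b).
Definition ad2 h : tensor L L -> tensor L L := tens_elim (fun a b => a ⊗ [Lie b, h]).

HB.instance Definition _ := GRing.Linear.on tens_lie.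
HB.instance Definition _ := GRing.Linear.on lie12.
HB.instance Definition _ := GRing.Linear.on lie23.
HB.instance Definition _ h := GRing.Linear.on (ad1 h).
HB.instance Definition _ h := GRing.Linear.on (ad2 h).

Lemma tens_lie_tens a b : tens_lie (a ⊗ b) = [Lie a, b].
Proof. by apply: tens_elim_tens; case: (lie_bilinear L). Qed.

Lemma ad1_tens h a b : ad1 h (a ⊗ b) = [Lie h, a] ⊗ b.
Proof.
apply: (tens_elim_tens (phi := fun a b => [Lie h, a] ⊗ b)) => [w|v] k x y.
  by rewrite lie_linearr tens_linearl.
by rewrite tens_linearr.
Qed.

Lemma ad2_tens h a b : ad2 h (a ⊗ b) = a ⊗ [Lie b, h].
Proof.
apply: (tens_elim_tens (phi := fun a b => a ⊗ [Lie b, h])) => [w|v] k x y.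
  by rewrite tens_linearl.
by rewrite lie_linearl tens_linearr.
Qed.

Lemma ad1_bilinear : bilinear_on ad1.
Proof.
split=> [T k h h'|h k T S]; last by rewrite linearP.
rewrite /ad1 /tens_elim scaler_sumr -big_split; apply: eq_bigr => i _ /=.
rewrite scaler_sumr -big_split; apply: eq_bigr => j _ /=.
by rewrite lie_linearl tens_linearl scalerDr !scalerA mulrC.
Qed.

Lemma ad2_bilinear : bilinear_on ad2.
Proof.
split=> [T k h h'|h k T S]; last by rewrite linearP.
rewrite /ad2 /tens_elim scaler_sumr -big_split; apply: eq_bigr => i _ /=.
rewrite scaler_sumr -big_split; apply: eq_bigr => j _ /=.
by rewrite lie_linearr tens_linearr scalerDr !scalerA mulrC.
Qed.

Lemma lie12_tens a b c : lie12 (a ⊗ b ⊗ c) = [Lie a, b] ⊗ c.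
Proof.
rewrite -tens_lie_tens.
apply: (tens_elim_tens (phi := fun (t : tensor L L) c => tens_lie t ⊗ c)) => [w|v] k x y.
  by rewrite linearP tens_linearl.
by rewrite tens_linearr.
Qed.

Lemma lie23_tens a b c : lie23 (a ⊗ b ⊗ c) = a ⊗ [Lie b, c].
Proof.
rewrite -ad2_tens.
apply: (tens_elim_tens (phi := fun (t : tensor L L) c => ad2 c t)) => [w|v].
  by case: ad2_bilinear.
by case: ad2_bilinear => + _; apply.
Qed.

Lemma tens_lift_bilinear (U : vectType F) (phi : L -> L -> L -> L -> U) :
  bilinear_on (tens_lift phi).
Proof. by split=> ?; [exact: tens_lift_linearl | exact: tens_lift_linearr]. Qed.

Lemma bilinear_comp (V W U U' : lmodType F) (f : {linear U -> U'}) (B : V -> W -> U) :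
  bilinear_on B -> bilinear_on (fun v w => f (B v w)).
Proof. by case=> Bl Br; split=> ? k x y; rewrite ?Bl ?Br linearP. Qed.

Lemma bilinearD (V W U : lmodType F) (B C : V -> W -> U) :
  bilinear_on B -> bilinear_on C -> bilinear_on (fun v w => B v w + C v w).
Proof.
by move=> [Bl Br] [Cl Cr]; split=> ? k x y; rewrite ?Bl ?Br ?Cl ?Cr scalerDr addrACA.
Qed.

(** On pure tensors both sides are [a, c] ⊗ [b, d]. This is the term Q common to the two diagonal
    identities. *)
Lemma lie12_bracket13_23 T S :
  lie12 (bracket13_23 T S) = lie23 (bracket12_13 T S).
Proof.
move: T S; apply: bilinear_tens_ext; try exact/bilinear_comp/tens_lift_bilinear.
by move=> a b c d; rewrite bracket13_23_tens bracket12_13_tens lie12_tens lie23_tens.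
Qed.

(** The Jacobi identity [[a, c], b] + [a, [b, c]] = [[a, b], c] in the first leg. *)
Lemma lie12_bracketD T S :
  lie12 (bracket12_13 T S) + lie12 (bracket12_23 T S) = ad1 (tens_lie T) S.
Proof.
move: T S; apply: (bilinear_tens_ext (C := fun T S => ad1 (tens_lie T) S)).
- by apply: bilinearD; exact/bilinear_comp/tens_lift_bilinear.
- by case: ad1_bilinear => adl adr; split=> // w k x y; rewrite linearP adl.
move=> a b c d; rewrite bracket12_13_tens bracket12_23_tens !lie12_tens.
by rewrite tens_lie_tens ad1_tens -tensDl (lie_lie a b c) (lieC [Lie a, c]) addrC.
Qed.

Lemma lie23_bracketD T S :
  lie23 (bracket12_23 T S) + lie23 (bracket13_23 T S) = ad2 (tens_lie S) T.
Proof.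
move: T S; apply: (bilinear_tens_ext (C := fun T S => ad2 (tens_lie S) T)).
- by apply: bilinearD; exact/bilinear_comp/tens_lift_bilinear.
- by case: ad2_bilinear => adl adr; split=> // w k x y; rewrite linearP adl.
move=> a b c d; rewrite bracket12_23_tens bracket13_23_tens !lie23_tens.
by rewrite tens_lie_tens ad2_tens -tensDr lie_lie subrK.
Qed.

Variables (e : (\dim {:L}).-tuple L).
Hypotheses (basis_e : basis_of {:L} e) (orthonormal_e : killing_orthonormal e).
Let Omega : tensor L L := \sum_(x <- e) x ⊗ x.

Lemma casimirE : Omega = \sum_(i < \dim {:L}) e`_i ⊗ e`_i.
Proof. by rewrite /Omega (big_nth 0) size_tuple big_mkord. Qed.

Lemma tens_lie_casimir : tens_lie Omega = 0.
Proof.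
rewrite /Omega linear_sum big1 // => x _.
exact: etrans (tens_lie_tens x x) (liexx x).
Qed.

Lemma casimir_linear (U : vectType F) (B : tensor L L -> tensor L L -> U) S :
  bilinear_on B ->
  B Omega S = tens_elim (fun a b => \sum_(i < \dim {:L}) B (e`_i ⊗ e`_i) (a ⊗ b)) S.
Proof.
case=> Bl Br; rewrite (linear_tens_sum S (Br _)); apply: eq_bigr => k _.
apply: eq_bigr => l _; congr (_ *: _).
pose fM := GRing.isLinear.Build _ _ _ _ _ (Bl ((vbasis {:L})`_k ⊗ (vbasis {:L})`_l)).
pose f : {linear tensor L L -> U} := HB.pack (B^~ ((vbasis {:L})`_k ⊗ (vbasis {:L})`_l)) fM.
by rewrite -[LHS]/(f Omega) casimirE linear_sum.
Qed.

Lemma casimir_linearr (U : vectType F) (B : tensor L L -> tensor L L -> U) T :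
  bilinear_on B ->
  B T Omega = tens_elim (fun a b => \sum_(i < \dim {:L}) B (a ⊗ b) (e`_i ⊗ e`_i)) T.
Proof. by case=> Bl Br; exact: (casimir_linear (B := fun T S => B S T)). Qed.

(** The Casimir operator acts on the first leg of S as 1. Since all four contractions with Omega are
    1 or -1, the pole of r contributes scalar multiples of r. *)
Lemma lie12_bracket12_23_casimir S : lie12 (bracket12_23 Omega S) = S.
Proof.
have /casimir_linear -> := bilinear_comp lie12 (tens_lift_bilinear
  (fun a b c d : L => a ⊗ [Lie b, c] ⊗ d)).
rewrite [RHS]tensorE; apply: eq_bigr => k _; apply: eq_bigr => l _; congr (_ *: _).
rewrite -[in RHS](casimir_adjoint basis_e orthonormal_e (vbasis {:L})`_k) tens_suml.
apply: eq_bigr => i _.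
transitivity (lie12 (bracket12_23 (e`_i ⊗ e`_i)
    ((vbasis {:L})`_k ⊗ (vbasis {:L})`_l))); first by [].
by rewrite bracket12_23_tens lie12_tens.
Qed.

Lemma lie23_bracket13_23_casimir T : lie23 (bracket13_23 T Omega) = - T.
Proof.
have /casimir_linearr -> := bilinear_comp lie23 (tens_lift_bilinear
  (fun a b c d : L => a ⊗ c ⊗ [Lie b, d])).
rewrite [in RHS](tensorE T) -scaleN1r scaler_sumr; apply: eq_bigr => k _.
rewrite scaler_sumr; apply: eq_bigr => l _; rewrite scalerA mulN1r -mulrN1 -scalerA.
congr (_ *: _).
rewrite -[in RHS](casimir_adjoint basis_e orthonormal_e (vbasis {:L})`_l) tens_sumr.
rewrite scaler_sumr; apply: eq_bigr => i _.
transitivity (lie23 (bracket13_23 ((vbasis {:L})`_k ⊗ (vbasis {:L})`_l)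
    (e`_i ⊗ e`_i))); first by [].
by rewrite bracket13_23_tens lie23_tens (lieC (vbasis _)`_l) linearN tensNr scaleN1r.
Qed.

(** The legs of Omega bracket to 0, so by [lie12_bracketD] the two contractions add up to 0. *)
Lemma lie12_bracket12_13_casimir S : lie12 (bracket12_13 Omega S) = - S.
Proof.
apply/eqP; rewrite -addr_eq0 -{2}[S]lie12_bracket12_23_casimir lie12_bracketD.
rewrite tens_lie_casimir; apply/eqP.
by have := ad1_bilinear.1 S (-1) 0 0; rewrite scaler0 addr0 scaleN1r addNr.
Qed.

Lemma lie23_bracket12_23_casimir T : lie23 (bracket12_23 T Omega) = T.
Proof.
have := lie23_bracketD T Omega; rewrite lie23_bracket13_23_casimir => e0.
apply/eqP; rewrite -subr_eq0 e0 tens_lie_casimir; apply/eqP.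
by have := ad2_bilinear.1 T (-1) 0 0; rewrite scaler0 addr0 scaleN1r addNr.
Qed.

End Legs.

(** * The Yang-Baxter equation on the diagonals *)

Lemma sum_triangle (V : nmodType) (M : nat) (Phi : nat -> nat -> V) :
  \sum_(u < M) \sum_(j < u.+1) Phi j (u - j)%N =
  \sum_(t < M) \sum_(j < (M - t)%N) Phi j t.
Proof.
elim: M => [|M IH]; first by rewrite !big_ord0.
rewrite big_ord_recr IH [RHS]big_ord_recr /= subSnn big_ord1.
have -> : \sum_(t < M) \sum_(j < (M.+1 - t)%N) Phi j t =
  \sum_(t < M) \sum_(j < (M - t)%N) Phi j t + \sum_(t < M) Phi (M - t)%N t.
  rewrite -big_split; apply: eq_bigr => t _; rewrite subSn ?(ltnW (ltn_ord t)) //.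
  by rewrite big_ord_recr.
rewrite -addrA; congr (_ + _); rewrite (reindex_inj rev_ord_inj) big_ord_recr /=.
rewrite subSS subnn subn0; congr (_ + _); apply: eq_bigr => t _.
by rewrite subSS subKn ?(ltnW (ltn_ord t)).
Qed.

Lemma sum_ord_shift (V : nmodType) (Y : nat -> V) (B M : nat) :
  (forall u, (u < B)%N -> Y u = 0) ->
  \sum_(u < (M + B)%N) Y u = \sum_(j < M) Y (j + B)%N.
Proof.
move=> Y0; rewrite -(big_mkord xpredT Y) (big_cat_nat (n := B)) ?leq_addl //=.
rewrite [X in X + _]big1_seq ?add0r; last first.
  by move=> u; rewrite mem_index_iota => /andP[_ /andP[_]]; exact: Y0.
by rewrite -{1}[B]add0n big_addn addnK big_mkord.
Qed.

Lemma sum_ord_trunc (V : nmodType) (Y : nat -> V) (M N : nat) : (M <= N)%N ->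
  (forall u, (M <= u)%N -> Y u = 0) -> \sum_(u < N) Y u = \sum_(u < M) Y u.
Proof.
move=> MN Y0; rewrite -(big_mkord xpredT Y) (big_cat_nat (n := M)) //= big_mkord.
rewrite [X in _ + X]big1_seq ?addr0 // => u.
by rewrite mem_index_iota => /andP[_ /andP[+ _]]; exact: Y0.
Qed.

Lemma fsbig_int (V : nmodType) (f : int -> V) (c : int) (M : nat) :
  (forall i : int, (c < i) || (i <= c - M%:Z) -> f i = 0) ->
  \sum_(i \in [set: int]) f i = \sum_(t < M) f (c - t%:Z).
Proof.
move=> f0; apply: (@fsbig_codom _ _ _ _ (fun t : 'I_M => c - t%:Z)).
  by move=> t t' tt'; apply: val_inj; move: tt' => /=; lia.
move=> i fi.
have [] : i <= c /\ c - M%:Z < i.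
  by split; rewrite ltNge || rewrite leNgt; apply: contraNN fi => ci; rewrite f0 ?ci ?orbT.
move: i {fi} => i ic ci; have tP : (`|c - i|%N < M)%N by lia.
by exists (Ordinal tP) => /=; lia.
Qed.

Lemma fsbig_nat (V : nmodType) (f : nat -> V) (M : nat) :
  (forall j, (M <= j)%N -> f j = 0) -> \sum_(j \in [set: nat]) f j = \sum_(j < M) f j.
Proof.
move=> f0; apply: (@fsbig_codom _ _ _ _ (fun j : 'I_M => j : nat)); first exact: val_inj.
move=> j fj; have jM : (j < M)%N by rewrite ltnNge; apply: contraNN fj => /f0 ->.
by exists (Ordinal jM).
Qed.

Section BilinearSums.
Variables (F : fieldType) (V W U : lmodType F) (B : V -> W -> U).
Hypothesis bilB : bilinear_on B.

Lemma bilinear_suml (I : Type) (r : seq I) (P : pred I) (G : I -> V) w :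
  B (\sum_(i <- r | P i) G i) w = \sum_(i <- r | P i) B (G i) w.
Proof.
pose fM := GRing.isLinear.Build _ _ _ _ _ (bilB.1 w).
pose f : {linear V -> U} := HB.pack (B^~ w) fM.
exact: (linear_sum f).
Qed.

Lemma bilinear_sumr (I : Type) (r : seq I) (P : pred I) (G : I -> W) v :
  B v (\sum_(i <- r | P i) G i) = \sum_(i <- r | P i) B v (G i).
Proof.
pose fM := GRing.isLinear.Build _ _ _ _ _ (bilB.2 v).
pose f : {linear W -> U} := HB.pack (B v) fM.
exact: (linear_sum f).
Qed.

Lemma bilinear0l w : B 0 w = 0.
Proof. by have := bilB.1 w (-1) 0 0; rewrite scaler0 addr0 scaleN1r addNr. Qed.

Lemma bilinear0r v : B v 0 = 0.
Proof. by have := bilB.2 v (-1) 0 0; rewrite scaler0 addr0 scaleN1r addNr. Qed.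

End BilinearSums.

Section DiagonalSums.
Variables (F : fieldType) (V : lmodType F) (Om : V) (s : fps F) (g : nat -> nat -> V).
Let r := pole_series Om s g.

Lemma pole_series_low (n : int) k : n < - k.+1%:Z -> r n k = 0.
Proof.
case: n => [n|n] nk; first by lia.
by rewrite /r pole_series_neg ifF ?scale0r //; apply/negbTE; lia.
Qed.

(* The coefficient of x^(a-1) in g(x, x). *)
Definition diag_coef (a : nat) : V := \sum_(j < a) g (a - j.+1)%N j.

(** The entries with j >= a have a negative exponent of x and all equal s_a Omega. There are J - a
    of them, so this part depends on the window, while the others form the coefficient of g(x,
    x). *)
Lemma sum_antidiag a J : (a <= J)%N ->
  \sum_(j < J) r (a%:Z - 1 - j%:Z) j = ((J - a)%:R * s a) *: Om + diag_coef a.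
Proof.
move=> aJ; rewrite -(big_mkord xpredT (fun j => r (a%:Z - 1 - j%:Z) j)).
rewrite (big_cat_nat (n := a)) //= addrC big_mkord; congr (_ + _); last first.
  apply: eq_bigr => j _; rewrite (_ : _ - _ = Posz (a - j.+1)%N); first exact: pole_series_pos.
  have := ltn_ord j; lia.
rewrite (eq_big_nat _ _ (F2 := fun=> s a *: Om)); last first.
  move=> j /andP[aj _]; rewrite (_ : _ - _ = Negz (j - a)%N); last by lia.
  by rewrite /r pole_series_neg leq_subr subKn.
by rewrite sumr_const_nat -scaler_nat scalerA.
Qed.

Lemma sum_antidiag0 (z : int) J : z < - 1 -> \sum_(j < J) r (z - j%:Z) j = 0.
Proof. by move=> z1; rewrite big1 // => j _; apply: pole_series_low; lia. Qed.

End DiagonalSums.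

Section DiagonalCYBE.
Variables (F : fieldType) (L : lieAlgType F).
Variables (e : (\dim {:L}).-tuple L).
Hypotheses (basis_e : basis_of {:L} e) (orthonormal_e : killing_orthonormal e).
Variables (s : fps F) (g : nat -> nat -> tensor L L).
Let Omega : tensor L L := \sum_(x <- e) x ⊗ x.
Let r := pole_series Omega s g.
Hypothesis cybe_r : CYBE r.
Local Notation G := (diag_coef g).

Let bil13 : bilinear_on (@bracket12_13 F L).
Proof. exact: tens_lift_bilinear. Qed.

Let bil23 : bilinear_on (@bracket12_23 F L).
Proof. exact: tens_lift_bilinear. Qed.

(* The coefficient of x^(nu-B) z^k on the diagonal x_1 = x_2 = x. The terms in Omega
   of the first two summands of the equation are not summable along the diagonal;
   on a finite window they cancel up to boundary terms, which form s d/dx. *)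
Lemma cybe_diag12 (B nu k : nat) : (k < B)%N ->
  \sum_(t < nu.+2) (((B%:R - t%:R) * s (nu.+1 - t)%N) *: r (t%:Z - B%:Z) k
     + ad1 (tens_lie (G (nu.+1 - t)%N)) (r (t%:Z - B%:Z) k))
  + \sum_(u < (nu + B).+1) \sum_(j < k.+1)
      lie12 (bracket13_23 (r (nu%:Z - u%:Z) j) (r (u%:Z - B%:Z) (k - j)%N)) = 0.
Proof.
move=> kB; pose rho t := r (t%:Z - B%:Z) k.
have bil1213 : bilinear_on (fun T S => lie12 (@bracket12_13 F L T S)).
  exact/bilinear_comp/tens_lift_bilinear.
have bil1223 : bilinear_on (fun T S => lie12 (@bracket12_23 F L T S)).
  exact/bilinear_comp/tens_lift_bilinear.
(* In both sums the terms are grouped by the exponent t - B of the second factor. The first factor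
   then runs over an antidiagonal, in a window of length nu + 1 here and nu + B + 1 - t in [S2]. *)
have S1 : \sum_(u < (nu + B).+1) lie12 (cybe12_13 r (nu%:Z - u%:Z) (u%:Z - B%:Z) k) =
  \sum_(t < (nu + B).+1)
    lie12 (bracket12_13 (\sum_(j < nu.+1) r (nu%:Z - t%:Z - j%:Z) j) (rho t)).
  rewrite -addSn (@sum_ord_shift _ (fun u =>
    lie12 (cybe12_13 r (nu%:Z - u%:Z) (u%:Z - B%:Z) k))); last first.
    move=> u uB.
    rewrite (_ : u%:Z - B%:Z = Negz (B - u.+1)%N); [exact: linear0|lia].
  under [RHS]eq_bigr => t _ do rewrite (bilinear_suml bil1213).
  rewrite [RHS]exchange_big; apply: eq_bigr => j _.
  rewrite (_ : (j + B)%N%:Z - B%:Z = j%:Z); last by lia.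
  rewrite /cybe12_13 (@fsbig_int _ _ (nu%:Z - j%:Z) (nu + B).+1).
    rewrite linear_sum; apply: eq_bigr => t _; congr (lie12 (bracket12_13 _ _)).
      by congr r; ring.
    by congr r; rewrite PoszD; ring.
  move=> i /orP[ij|ij].
    by rewrite [X in bracket12_13 _ X]pole_series_low ?(bilinear0r bil13) //; lia.
  by rewrite [X in bracket12_13 X _]pole_series_low ?(bilinear0l bil13) //; lia.
have S2 : \sum_(u < (nu + B).+1) lie12 (cybe12_23 r (nu%:Z - u%:Z) (u%:Z - B%:Z) k) =
  \sum_(t < (nu + B).+1)
    lie12 (bracket12_23 (\sum_(j < ((nu + B).+1 - t)%N) r (nu%:Z - t%:Z - j%:Z) j) (rho t)).
  under [RHS]eq_bigr => t _ do rewrite (bilinear_suml bil1223).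
  rewrite -(sum_triangle _ (fun j t =>
    lie12 (bracket12_23 (r (nu%:Z - t%:Z - j%:Z) j) (rho t)))).
  apply: eq_bigr => u _; rewrite /cybe12_23.
  rewrite (@fsbig_nat _ _ u.+1).
    rewrite linear_sum; apply: eq_bigr => j _; have ju := leq_ord j.
    congr (lie12 (bracket12_23 _ _)); first by congr r; rewrite -subzn //; ring.
    by rewrite /rho; congr r; rewrite -subzn //; ring.
  move=> j uj.
  by rewrite [X in bracket12_23 _ X]pole_series_low ?(bilinear0r bil23) //; lia.
have e0 : \sum_(u < (nu + B).+1) lie12 (cybe12_13 r (nu%:Z - u%:Z) (u%:Z - B%:Z) k) +
    \sum_(u < (nu + B).+1) lie12 (cybe12_23 r (nu%:Z - u%:Z) (u%:Z - B%:Z) k) +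
    \sum_(u < (nu + B).+1) lie12 (cybe13_23 r (nu%:Z - u%:Z) (u%:Z - B%:Z) k) = 0.
  by rewrite -!big_split big1 // => u _; rewrite /= -!linearD cybe_r linear0.
rewrite S1 S2 in e0.
rewrite -[RHS]e0; congr (_ + _); last first.
  by apply: eq_bigr => u _; rewrite linear_sum.
rewrite -big_split.
(* For t > nu + 1 the antidiagonals have total degree below -1 and vanish. The value t = nu + 1
   stays, as degree -1 still contains s_0 Omega. *)
have nuB : (nu.+2 <= (nu + B).+1)%N by lia.
rewrite (@sum_ord_trunc _ (fun t =>
  lie12 (bracket12_13 (\sum_(j < nu.+1) r (nu%:Z - t%:Z - j%:Z) j) (rho t)) +
  lie12 (bracket12_23 (\sum_(j < ((nu + B).+1 - t)%N) r (nu%:Z - t%:Z - j%:Z) j)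
    (rho t))) _ _ nuB); last first.
  move=> t nut.
  by rewrite !sum_antidiag0 ?(bilinear0l bil1213) ?(bilinear0l bil1223) ?addr0 //; lia.
apply: eq_bigr => t _; have tnu := ltn_ord t.
have -> : nu%:Z - t%:Z = (nu.+1 - t)%N%:Z - 1 by lia.
rewrite !sum_antidiag; [|lia|lia].
rewrite bil1213.1 bil1223.1 lie12_bracket12_13_casimir // lie12_bracket12_23_casimir //.
rewrite addrACA lie12_bracketD scalerN -scaleNr -scalerDl; congr (_ *: _ + _).
rewrite -mulNr -mulrDl; congr (_ * _).
(* The windows contain the pole term t and B times, with opposite signs. The resulting B - t is
   minus the exponent of x, whence - s d/dx. *)
have -> : (nu.+1 - (nu.+1 - t) = t)%N by lia.
have -> : ((nu + B).+1 - t - (nu.+1 - t) = B)%N by lia.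
by rewrite addrC.
Qed.

(** The coefficient of x^(nu-B) z^k on the diagonal x_2 = x_3 = z. The windows are chosen so that
    the pole terms leave the factor j, the exponent of z, whence s d/dz. *)
Lemma cybe_diag23 (B nu k : nat) : (k < B)%N ->
  \sum_(j < k.+2) ((j%:R * s (k.+1 - j)%N) *: r (nu%:Z - B%:Z) j
     + ad2 (tens_lie (G (k.+1 - j)%N)) (r (nu%:Z - B%:Z) j))
  + \sum_(u < (nu + B).+1) \sum_(j < k.+1)
      lie23 (bracket12_13 (r (nu%:Z - u%:Z) j) (r (u%:Z - B%:Z) (k - j)%N)) = 0.
Proof.
move=> kB; set n := nu%:Z - B%:Z.
have bil1223 : bilinear_on (fun T S => lie23 (@bracket12_23 F L T S)).
  exact/bilinear_comp/tens_lift_bilinear.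
have bil1323 : bilinear_on (fun T S => lie23 (@bracket13_23 F L T S)).
  exact/bilinear_comp/tens_lift_bilinear.
have S1 : \sum_(l < k.+1) lie23 (cybe12_13 r n (k%:Z - l%:Z) l) =
  \sum_(u < (nu + B).+1) \sum_(j < k.+1)
      lie23 (bracket12_13 (r (nu%:Z - u%:Z) j) (r (u%:Z - B%:Z) (k - j)%N)).
  rewrite [RHS]exchange_big [LHS](reindex_inj rev_ord_inj); apply: eq_bigr => j _ /=.
  have jk := leq_ord j; rewrite subSS (_ : k%:Z - (k - j)%N%:Z = j%:Z); last by lia.
  rewrite /cybe12_13 (@fsbig_int _ _ nu%:Z (nu + B).+1).
    rewrite linear_sum; apply: eq_bigr => u _; congr (lie23 (bracket12_13 _ _)).
    by congr r; rewrite /n; ring.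
  move=> i /orP[ij|ij].
    by rewrite [X in bracket12_13 _ X]pole_series_low ?(bilinear0r bil13) //; rewrite /n; lia.
  by rewrite [X in bracket12_13 X _]pole_series_low ?(bilinear0l bil13) //; lia.
have S2 : \sum_(l < k.+1) lie23 (cybe12_23 r n (k%:Z - l%:Z) l) =
  \sum_(j < k.+2) lie23 (bracket12_23 (r n j) (\sum_(l < k.+1) r (k%:Z - j%:Z - l%:Z) l)).
  under [RHS]eq_bigr => j _ do rewrite (bilinear_sumr bil1223).
  rewrite [RHS]exchange_big; apply: eq_bigr => l _; rewrite /cybe12_23.
  rewrite (@fsbig_nat _ _ k.+2).
    rewrite linear_sum; apply: eq_bigr => j _.
    by congr (lie23 (bracket12_23 _ _)); congr r; ring.
  move=> j kj.
  by rewrite [X in bracket12_23 _ X]pole_series_low ?(bilinear0r bil23) //; lia.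
have S3 : \sum_(l < k.+1) lie23 (cybe13_23 r n (k%:Z - l%:Z) l) =
  \sum_(j < k.+2) lie23 (bracket13_23 (r n j)
     (\sum_(l < (k.+1 - j)%N) r (k%:Z - j%:Z - l%:Z) l)).
  rewrite [RHS]big_ord_recr /= subnn big_ord0 (bilinear0r bil1323) addr0.
  under [RHS]eq_bigr => j _ do rewrite (bilinear_sumr bil1323).
  rewrite [RHS](_ : _ = \sum_(t < k.+1) \sum_(j < (k.+1 - t)%N)
    lie23 (bracket13_23 (r n t) (r (k%:Z - t%:Z - j%:Z) j))) //.
  rewrite -(sum_triangle _ (fun j t =>
    lie23 (bracket13_23 (r n t) (r (k%:Z - t%:Z - j%:Z) j)))).
  apply: eq_bigr => l _; rewrite /cybe13_23 linear_sum (reindex_inj rev_ord_inj).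
  apply: eq_bigr => j _; have jl := leq_ord j; rewrite /= subSS subKn //.
  by congr (lie23 (bracket13_23 _ _)); congr r; rewrite -subzn //; ring.
have e0 : \sum_(l < k.+1) lie23 (cybe12_13 r n (k%:Z - l%:Z) l) +
    \sum_(l < k.+1) lie23 (cybe12_23 r n (k%:Z - l%:Z) l) +
    \sum_(l < k.+1) lie23 (cybe13_23 r n (k%:Z - l%:Z) l) = 0.
  by rewrite -!big_split big1 // => u _; rewrite /= -!linearD cybe_r linear0.
rewrite S1 S2 S3 -addrA addrC in e0.
rewrite -[RHS]e0; congr (_ + _); rewrite -big_split; apply: eq_bigr => j _.
have jk := leq_ord j.
have -> : k%:Z - j%:Z = (k.+1 - j)%N%:Z - 1 by lia.
rewrite !sum_antidiag; [|lia|lia].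
rewrite bil1223.2 bil1323.2 lie23_bracket13_23_casimir // lie23_bracket12_23_casimir //.
rewrite [RHS]addrACA lie23_bracketD scalerN -scaleNr -scalerDl; congr (_ *: _ + _).
rewrite -mulNr -mulrDl; congr (_ * _).
(* The window of the (12, 23) term contains the pole term j times, that of the (13, 23) term not at
   all. *)
have -> : (k.+1 - (k.+1 - j) = j)%N by lia.
by rewrite subnn oppr0 addr0.
Qed.

End DiagonalCYBE.

(** * Orders of vanishing *)

Section FiniteOrbit.
Variables (F : fieldType).
Hypothesis charF0 : [pchar F] =i pred0.
Implicit Types (s f g : fps F) (m n o : nat).

Lemma zero_multM f g m o : (forall i, (i < m)%N -> f i = 0) ->
    (forall i, (i < o)%N -> g i = 0) ->
  (forall n, (n < m + o)%N -> (f * g) n = 0) /\ (f * g) (m + o)%N = f m * g o.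
Proof.
move=> f0 g0; have fg i n : (n < m + o)%N || (i != m) && (n == m + o)%N -> (i <= n)%N ->
    f i * g (n - i)%N = 0.
  move=> H i_n; case: (ltnP i m) => [im|mi]; first by rewrite f0 ?mul0r.
  rewrite g0 ?mulr0 //; lia.
split=> [n nmo|].
  by rewrite fpsM big1 // => i _; rewrite fg ?nmo // leq_ord.
have mP : (m < (m + o).+1)%N by rewrite ltnS leq_addr.
rewrite fpsM (bigD1 (Ordinal mP)) //= addKn big1 ?addr0 // => i im.
rewrite fg ?leq_ord // eqxx andbT; apply/orP; right.
by apply: contraNneq im => im; apply/eqP/val_inj.
Qed.

Variables (s : fps F) (c : nat).

(* In terms of the Laurent series x^(-c) g, this is the derivation s d/dx. *)
Definition shifted_deriv g : fps F :=
  fun n => (s * (fps_euler g - fpsC c%:R * g)) n.+1.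

Lemma natr_subr_neq0 o : o != c -> o%:R - c%:R != 0 :> F.
Proof.
have key a b : (a < b)%N -> b%:R - a%:R != 0 :> F.
  move=> ab; rewrite -natrB ?(ltnW ab) //; have := ab; rewrite -subn_gt0.
  by case: (b - a)%N => // d _; exact: natrS_neq0.
case: ltngtP => // oc _; last exact: key.
by rewrite -opprB oppr_eq0 key.
Qed.

(** Applying s d/dx to x^(o-c) gives s_m (o - c) x^(o-c+m-1) + ..., so the leading term is lost
    exactly when the Laurent order o - c is 0. *)
Lemma shifted_deriv_zero_mult g m o : (0 < m)%N -> zero_mult s m -> zero_mult g o ->
  (forall n, (n < o + m.-1)%N -> shifted_deriv g n = 0) /\
  shifted_deriv g (o + m.-1)%N = s m * ((o%:R - c%:R) * g o).
Proof.
move=> m0 [s_low _] [g_low _].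
have hE n : (fps_euler g - fpsC c%:R * g) n = (n%:R - c%:R) * g n.
  by rewrite fpsB fpsCM mulrBl.
have [] := @zero_multM s (fps_euler g - fpsC c%:R * g) m o s_low.
  by move=> i io; rewrite hE g_low ?mulr0.
move=> low lead; split=> [n nmo|]; first by apply: low; lia.
by rewrite /shifted_deriv -hE -lead; congr (_ _); lia.
Qed.

Lemma shifted_deriv_mult g m o : (0 < m)%N -> zero_mult s m -> zero_mult g o ->
  o != c -> zero_mult (shifted_deriv g) (o + m.-1).
Proof.
move=> m0 sm go oc; have [low lead] := shifted_deriv_zero_mult m0 sm go.
split=> //; rewrite lead !mulf_neq0 ?natr_subr_neq0 //; first exact: sm.2.
exact: go.2.
Qed.

(* Iterating an operator that raises the order strictly produces infinitely
   many linearly independent series, which no finite family can span. *)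
Lemma finite_orbit n (u : 'I_n -> fps F) (N : 'M[F]_n) :
    (forall p i, shifted_deriv (u p) i = \sum_q N p q * u q i) ->
  forall p (o : nat -> nat), (forall k, (o k < o k.+1)%N) ->
  ~ (forall k, zero_mult (iter k shifted_deriv (u p)) (o k)).
Proof.
move=> uN p o o_lt u_o.
pose a k : 'rV[F]_n := iter k (mulmx^~ N) (delta_mx 0 p).
have aE k i : iter k shifted_deriv (u p) i = \sum_q a k 0 q * u q i.
  elim: k i => [|k IH] i.
    rewrite (bigD1 p) //= mxE !eqxx mul1r big1 ?addr0 // => q /negPf qp.
    by rewrite mxE qp andbF mul0r.
  have -> : iter k.+1 shifted_deriv (u p) i =
      \sum_q a k 0 q * shifted_deriv (u q) i.
    rewrite iterS /shifted_deriv; under [RHS]eq_bigr => q _ do rewrite fpsM mulr_sumr.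
    rewrite exchange_big fpsM; apply: eq_bigr => j _.
    rewrite fpsB fpsCM /fps_euler -mulrBl IH !mulr_sumr; apply: eq_bigr => q _.
    by rewrite fpsB fpsCM /fps_euler -mulrBl; ring.
  under eq_bigr => q _ do rewrite uN mulr_sumr.
  rewrite exchange_big; apply: eq_bigr => q _; rewrite [a k.+1]iterS mxE mulr_suml.
  by apply: eq_bigr => j _; rewrite mulrA.
(* The n + 1 rows of coordinates have length n, so there is a nontrivial relation [l] among the
   first n + 1 iterates. *)
pose A := \matrix_(k < n.+1) a k.
have : kermx A != 0.
  rewrite -mxrank_eq0 mxrank_ker -lt0n subn_gt0 ltnS; exact: rank_leq_col.
case/rowV0Pn => l /sub_kermxP lA l0.
have [k lk lk_min] : exists2 k, l 0 k != 0 & forall j : 'I_n.+1, (j < k)%N -> l 0 j = 0.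
  have /existsP [k0 lk0] : [exists k, l 0 k != 0].
    rewrite -negb_forall; apply: contraNN l0 => /forallP l0.
    by apply/eqP/rowP => k; rewrite mxE; exact/eqP.
  case: (@arg_minnP _ k0 (fun k => l 0 k != 0) val lk0) => k lk k_min.
  exists k => // j jk; apply/eqP; apply: contraLR jk => lj; rewrite -leqNgt.
  exact: k_min.
have o_mono i j : (i < j)%N -> (o i < o j)%N.
  by apply: (homo_ltn (f := o) (r := fun x y => (x < y)%N)) => [y x z|];
    [exact: ltn_trans|exact: o_lt].
(* In degree [o k], with k the least index in the relation, only the k-th iterate contributes, as
   later ones start in higher degrees. *)
have : \sum_(j < n.+1) l 0 j * iter j shifted_deriv (u p) (o k) = 0.
  under eq_bigr => j _ do rewrite aE mulr_sumr.
  rewrite exchange_big big1 // => q _.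
  move/rowP: lA => /(_ q); rewrite !mxE => lAq.
  under eq_bigr => j _ do rewrite mulrA.
  rewrite -mulr_suml -[X in X * _](_ : \sum_j l 0 j * A j q = _).
    by rewrite lAq mul0r.
  by apply: eq_bigr => j _; rewrite mxE.
rewrite (bigD1 k) //= big1 ?addr0 => [/eqP|j jk].
  by rewrite mulf_eq0 (negPf lk) (negPf (u_o k).2).
case: (ltngtP j k) => [jk'|kj|/val_inj e]; first by rewrite lk_min ?mul0r.
  by rewrite (u_o j).1 ?mulr0 // o_mono.
by rewrite e eqxx in jk.
Qed.

(** If the orders avoided c, each step would raise them by m - 1 > 0 forever, against
    [finite_orbit]. *)
Lemma finite_orbit_mult n (u : 'I_n -> fps F) (N : 'M[F]_n) m p o :
    (forall p i, shifted_deriv (u p) i = \sum_q N p q * u q i) ->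
    (1 < m)%N -> zero_mult s m -> zero_mult (u p) o ->
  exists k, (o + k * m.-1)%N = c.
Proof.
move=> uN m1 sm uo; apply: contrapT => no_k.
apply: (finite_orbit uN (p := p) (o := fun k => (o + k * m.-1)%N)) => k.
  by rewrite ltn_add2l ltn_mul2r; lia.
elim: k => [|k IH]; first by rewrite mul0n addn0.
rewrite iterS mulSn (addnC m.-1) addnA; apply: shifted_deriv_mult => //; first by lia.
by apply/eqP => e; apply: no_k; exists k.
Qed.

Lemma eulerE g n : (fps_euler g - fpsC c%:R * g) n = (n%:R - c%:R) * g n.
Proof. by rewrite fpsB fpsCM mulrBl. Qed.

Lemma zero_mult2_coef f g n : f 0%N = 0 -> f 1%N = 0 ->
  (forall i, (i < n)%N -> g i = 0) ->
  (f * g) n.+3 = f 2%N * g n.+1 + f 3%N * g n.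
Proof.
move=> f0 f1 g0; rewrite fpsM !big_ord_recl /= f0 f1 !mul0r !add0r /bump /=.
rewrite big1 ?addr0 => [|i _]; last by rewrite g0 ?mulr0 //= /bump /=; have := ltn_ord i; lia.
by rewrite !subSS !subn0.
Qed.

(** The iterates [w 0], [w 1], [w 2] have Laurent orders -2, -1, 0. Finiteness forces [w 3] to
    vanish, which makes [w 2] constant up to the next coefficient; that coefficient is - s_3 times
    the leading one of [w 1]. *)
Lemma finite_orbit_mult2 n (u : 'I_n -> fps F) (N : 'M[F]_n) p :
    (forall p i, shifted_deriv (u p) i = \sum_q N p q * u q i) ->
    zero_mult s 2 -> (1 < c)%N -> zero_mult (u p) (c - 2) ->
  s 3%N = 0.
Proof.
move=> uN s2 c1 u0.
pose w k := iter k shifted_deriv (u p).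
have w1 : zero_mult (w 1%N) (c - 1).
  have -> : (c - 1)%N = (c - 2 + 2.-1)%N by lia.
  by apply: shifted_deriv_mult => //; lia.
have w2 : zero_mult (w 2%N) c.
  have -> : c = (c - 1 + 2.-1)%N by lia.
  by apply: shifted_deriv_mult => //; lia.
have [w3_low w3_lead] := shifted_deriv_zero_mult (isT : (0 < 2)%N) s2 w2.
(* The leading term of [w 2] is killed, so a nonzero [w 3] would have order n0 > c. The orders would
   then rise strictly forever. *)
have w3 : w 3%N = 0.
  apply/eqP; apply: contraT => w3n0.
  have exn : exists n, w 3%N n != 0.
    apply: contrapT => no_n; case/negP: w3n0; apply/eqP/funext => i.
    by apply/eqP; apply: contraT => wi; case: no_n; exists i.
  pose n0 := ex_minn exn.
  have [wn0 n0_min] : w 3%N n0 != 0 /\ forall i, w 3%N i != 0 -> (n0 <= i)%N.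
    by rewrite /n0; case: ex_minnP.
  have cn0 : (c < n0)%N.
    rewrite ltnNge; apply: contraNN wn0 => nc.
    by rewrite [w 3%N n0]w3_low //; lia.
  have w3' k : zero_mult (w (k + 3)%N) (n0 + k).
    elim: k => [|k IH].
      rewrite addn0; split=> // i i_n0; apply/eqP; apply: contraTT i_n0 => wi.
      by rewrite -leqNgt n0_min.
    rewrite addSn [w _]iterS (_ : (n0 + k.+1 = n0 + k + 2.-1)%N); last by lia.
    by apply: shifted_deriv_mult => //; lia.
  case: (finite_orbit uN (p := p)
    (o := fun k => if (k < 3)%N then (c - 2 + k)%N else (n0 + (k - 3))%N)).
    move=> k /=; case: ifP => k3; case: ifP => k3'; lia.
  case=> [|[|[|k]]] /=; first by rewrite addn0.
  - by have -> : (c - 2 + 1 = c - 1)%N by lia.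
  - by have -> : (c - 2 + 2 = c)%N by lia.
  by have := w3' k; rewrite addn3 ?subSS ?subn0.
(* The coefficient of degree c + 2 of [w 3] is s_2 times this one, since the degree c part of [w 2]
   is annihilated. *)
have w2_next : w 2%N c.+1 = 0.
  have : (s * (fps_euler (w 2%N) - fpsC c%:R * w 2%N)) c.+3 = 0.
    exact: (congr1 (fun f : fps F => f c.+2) w3).
  rewrite (zero_mult2_coef (s2.1 0%N isT) (s2.1 1%N isT)); last first.
    by move=> i ic; rewrite eulerE w2.1 ?mulr0.
  rewrite !eulerE subrr mul0r mulr0 addr0 -[c.+1]addn1 natrD addrAC subrr add0r mul1r.
  by move=> /eqP; rewrite mulf_eq0 (negPf s2.2) => /eqP.
(* The coefficient of [w 2] just found to be 0, computed from [w 1]: the s_2 term has the factor c -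
   c, so only - s_3 times the leading coefficient remains. *)
have : (s * (fps_euler (w 1%N) - fpsC c%:R * w 1%N)) (c - 1).+3 = 0.
  by rewrite (_ : (c - 1).+3 = c.+2) //; lia.
rewrite (zero_mult2_coef (s2.1 0%N isT) (s2.1 1%N isT)); last first.
  by move=> i ic; rewrite eulerE w1.1 ?mulr0.
have -> : (c - 1).+1 = c by lia.
rewrite !eulerE subrr mul0r mulr0 add0r => /eqP.
rewrite !mulf_eq0 (negPf w1.2) orbF => /orP[/eqP //|].
by rewrite (negPf (natr_subr_neq0 _)) //; lia.
Qed.

End FiniteOrbit.

(** The Leibniz rule for the pairing of the vectors x^(-b) x_i, written in an orthonormal basis. The
    antisymmetric [H], an infinitesimal isometry, drops out, so s d/dx maps the pairings into their
    own span. *)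
Lemma shifted_deriv_contraction (F : fieldType) (I A : finType) (s : fps F) (b : nat)
    (x : I -> A -> fps F) (H : A -> A -> fps F) (M : I -> I -> F) :
    (forall a c, H a c = - H c a) ->
    (forall i a, s * (fps_euler (x i a) - fpsC b%:R * x i a) =
       \sum_c H a c * x i c + fpsX F * \sum_j fpsC (M i j) * x j a) ->
  let f i i' := \sum_a x i a * x i' a in
  forall i i' n, shifted_deriv s (b + b) (f i i') n =
    \sum_j M i j * f j i' n + \sum_j M i' j * f i j n.
Proof.
move=> H_anti xE f i i' n.
have euler_sum (h : A -> fps F) : fps_euler (\sum_a h a) = \sum_a fps_euler (h a).
  elim/big_rec2: _ => [|a g k _ <-]; last by rewrite fps_eulerD.
  by apply/funext => k; rewrite /fps_euler mulr0.
have CD : fpsC (b + b)%:R = fpsC b%:R + fpsC b%:R :> fps F.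
  by apply/funext => -[|k]; rewrite fpsD /= ?natrD ?addr0.
have fE : s * (fps_euler (f i i') - fpsC (b + b)%:R * f i i') =
    fpsX F * (\sum_j fpsC (M i j) * f j i' + \sum_j fpsC (M i' j) * f i j).
  transitivity (\sum_a ((s * (fps_euler (x i a) - fpsC b%:R * x i a)) * x i' a +
      x i a * (s * (fps_euler (x i' a) - fpsC b%:R * x i' a)))).
    rewrite euler_sum CD mulr_sumr -sumrB mulr_sumr; apply: eq_bigr => a _.
    by rewrite fps_eulerM; ring.
  under eq_bigr => a _ do rewrite !xE mulrDl mulrDr addrACA.
  rewrite big_split /= [X in X + _](_ : _ = 0) ?add0r.
    rewrite mulrDr big_split /= !mulr_sumr; congr (_ + _).
      under eq_bigr => a _ do rewrite -mulrA mulr_suml mulr_sumr.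
      rewrite exchange_big; apply: eq_bigr => j _; rewrite !mulr_sumr.
      by apply: eq_bigr => a _; ring.
    under eq_bigr => a _ do rewrite mulrCA mulr_sumr mulr_sumr.
    rewrite exchange_big; apply: eq_bigr => j _; rewrite !mulr_sumr.
    by apply: eq_bigr => a _; ring.
  (* The terms with [H a c] and [H c a] cancel. *)
  rewrite big_split /=; under eq_bigr => a _ do rewrite mulr_suml.
  under [X in _ + X]eq_bigr => a _ do rewrite mulr_sumr.
  rewrite [X in _ + X]exchange_big -big_split big1 // => a _ /=.
  by rewrite -big_split big1 // => c _; rewrite /= (H_anti c a); ring.
rewrite /shifted_deriv fE fpsXM fpsD !fps_sumE.
by congr (_ + _); apply: eq_bigr => j _; rewrite fpsCM.
Qed.

Lemma linear_tens_ext (F : fieldType) (V W U : vectType F) (f g : tensor V W -> U) T :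
  linear f -> linear g -> (forall v w, f (v ⊗ w) = g (v ⊗ w)) -> f T = g T.
Proof.
move=> fL gL fg; rewrite (linear_tens_sum T fL) (linear_tens_sum T gL).
by apply: eq_bigr => i _; apply: eq_bigr => j _; rewrite fg.
Qed.

(** * Coordinates with respect to the orthonormal basis *)

Section TensorCoefficients.
Variables (F : fieldType) (L : lieAlgType F).
Variables (e : (\dim {:L}).-tuple L).
Hypotheses (basis_e : basis_of {:L} e) (orthonormal_e : killing_orthonormal e).
Local Notation d := (\dim {:L}).
Implicit Types (a b h : L) (T : tensor L L) (al be ga : 'I_d).
Let Omega : tensor L L := \sum_(x <- e) x ⊗ x.

(** The coordinate along e_al ⊗ e_be. The basis [e] replaces [vbasis] since ad h has an
    antisymmetric matrix in it. *)
Definition tens_coef al be : tensor L L -> F^o :=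
  tens_elim (fun a b => killing e`_al a * killing e`_be b : F^o).

HB.instance Definition _ al be := GRing.Linear.on (tens_coef al be).

Lemma tens_coefP al be k T S :
  tens_coef al be (k *: T + S) = k * tens_coef al be T + tens_coef al be S.
Proof. exact: linearP. Qed.

Lemma tens_coef_tens al be a b :
  tens_coef al be (a ⊗ b) = killing e`_al a * killing e`_be b.
Proof.
apply: (tens_elim_tens (phi := fun a b => killing e`_al a * killing e`_be b : F^o)) => ? k x y.
  by rewrite linearP mulrDl -mulrA.
by rewrite linearP mulrDr mulrCA.
Qed.

Lemma tens_coef_casimir al be : tens_coef al be Omega = (al == be)%:R.
Proof.
rewrite /Omega casimirE linear_sum (bigD1 al) //= big1 ?addr0 => [|i ia].
  rewrite [LHS]tens_coef_tens !orthonormal_e eqxx mul1r eq_sym //.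
by rewrite [LHS]tens_coef_tens !orthonormal_e eq_sym (negPf ia) mul0r.
Qed.

Lemma tens_coef_ad1 h al be T :
  tens_coef al be (ad1 h T) =
  \sum_(ga < d) killing e`_al [Lie h, e`_ga] * tens_coef ga be T.
Proof.
apply: (linear_tens_ext (f := fun T => tens_coef al be (ad1 h T))
  (g := fun T => \sum_(ga < d) killing e`_al [Lie h, e`_ga] * tens_coef ga be T)).
- by move=> k x y; rewrite !linearP.
- move=> k x y; rewrite scaler_sumr -big_split; apply: eq_bigr => ga _.
  by rewrite linearP mulrDr mulrCA.
move=> a b; rewrite ad1_tens tens_coef_tens {1}(killing_expand basis_e orthonormal_e a).
rewrite linear_sum linear_sum mulr_suml; apply: eq_bigr => ga _.
by rewrite !linearZ tens_coef_tens mulrA; congr (_ * _); exact: mulrC.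
Qed.

Lemma tens_coef_ad2 h al be T :
  tens_coef al be (ad2 h T) =
  \sum_(ga < d) killing e`_be [Lie e`_ga, h] * tens_coef al ga T.
Proof.
apply: (linear_tens_ext (f := fun T => tens_coef al be (ad2 h T))
  (g := fun T => \sum_(ga < d) killing e`_be [Lie e`_ga, h] * tens_coef al ga T)).
- by move=> k x y; rewrite !linearP.
- move=> k x y; rewrite scaler_sumr -big_split; apply: eq_bigr => ga _.
  by rewrite linearP mulrDr mulrCA.
move=> a b; rewrite ad2_tens tens_coef_tens {1}(killing_expand basis_e orthonormal_e b).
rewrite lie_suml linear_sum mulr_sumr; apply: eq_bigr => ga _.
rewrite lieZl linearZ tens_coef_tens.
exact: etrans (mulrA _ _ _) (mulrC _ _).
Qed.

End TensorCoefficients.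

(** * Zeros of s of multiplicity at least 2 *)

Section Multiplicity.
Variables (F : fieldType) (L : lieAlgType F).
Hypothesis charF0 : [pchar F] =i pred0.
Variables (e : (\dim {:L}).-tuple L).
Hypotheses (basis_e : basis_of {:L} e) (orthonormal_e : killing_orthonormal e).
Variables (s : fps F) (g : nat -> nat -> tensor L L) (m : nat) (be0 : 'I_(\dim {:L})).
Let Omega : tensor L L := \sum_(x <- e) x ⊗ x.
Let r := pole_series Omega s g.
Hypotheses (cybe_r : CYBE r) (m_gt1 : (1 < m)%N) (s_m : zero_mult s m).
Local Notation d := (\dim {:L}).
Local Notation B := m.+2.
Local Notation I := ('I_B * 'I_d)%type.

Let eta a := tens_lie (diag_coef g a).
(** The matrix of x ad h(x): [eta a] is the coefficient of x^(a-1) in h. *)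
Let H (al ga : 'I_d) : fps F := fun a => killing e`_al [Lie eta a, e`_ga].
(* Multiplication by x^B clears the poles of the coefficient of y^k for k < B. *)
Let x (i : I) (al : 'I_d) : fps F :=
  fun t => tens_coef e al i.2 (r (t%:Z - B%:Z) i.1).
(** The matrix of - (s d/dz + [ad2] h) on the coefficients of z^k for k < B. *)
Let M (i j : I) : F :=
  if (j.1 <= i.1)%N then
    - ((if j.2 == i.2 then j.1%:R * s (i.1.+1 - j.1)%N else 0)
       + killing e`_i.2 [Lie e`_j.2, eta (i.1.+1 - j.1)%N])
  else 0.

Let H_anti al ga : H al ga = - H ga al.
Proof.
apply/funext => a; rewrite -[RHS]/(- H ga al a) /H -killing_lie killingC.
by rewrite (lieC e`_al) killingNr.
Qed.

(** The identities on the two diagonals, subtracted and read in coordinates; the factor x clears the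
    shift in [eta] and in d/dx. *)
Let x_eq i al : s * (fps_euler (x i al) - fpsC B%:R * x i al) =
  \sum_ga H al ga * x i ga + fpsX F * \sum_j fpsC (M i j) * x j al.
Proof.
have s0 : s 0%N = 0 by apply: s_m.1; lia.
have s1 : s 1%N = 0 by apply: s_m.1.
have eta0 : eta 0%N = 0 by rewrite /eta /diag_coef big_ord0 linear0.
apply/funext => -[|nu].
  rewrite fpsD fpsXM addr0 fpsM big_ord1 s0 mul0r fps_sumE big1 // => ga _.
  by rewrite fpsM big_ord1 /H eta0 (lieC 0) linear0 oppr0 linear0 mul0r.
rewrite fpsD fpsXM !fps_sumE.
case: i => k be; have kB := ltn_ord k.
have e1 := cybe_diag12 basis_e orthonormal_e cybe_r nu kB.
have e2 := cybe_diag23 basis_e orthonormal_e cybe_r nu kB.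
have QE : \sum_(u < (nu + B).+1) \sum_(j < k.+1)
      lie12 (bracket13_23 (r (nu%:Z - u%:Z) j) (r (u%:Z - B%:Z) (k - j)%N)) =
    \sum_(u < (nu + B).+1) \sum_(j < k.+1)
      lie23 (bracket12_13 (r (nu%:Z - u%:Z) j) (r (u%:Z - B%:Z) (k - j)%N)).
  by apply: eq_bigr => u _; apply: eq_bigr => j _; exact: lie12_bracket13_23.
(* Both identities end in the same sum Q, so their first sums agree. *)
rewrite QE in e1; have {e1 e2 QE} := addIr _ (etrans e1 (esym e2)).
move=> /(congr1 (tens_coef e al be)); rewrite !linear_sum => e3.
set i : I := (k, be).
have lhsE : \sum_(t < nu.+2) tens_coef e al be
     (((B%:R - t%:R) * s (nu.+1 - t)%N) *: r (t%:Z - B%:Z) k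
     + ad1 (eta (nu.+1 - t)) (r (t%:Z - B%:Z) k)) =
    \sum_ga (H al ga * x i ga) nu.+1
    - (s * (fps_euler (x i al) - fpsC B%:R * x i al)) nu.+1.
  have -> : \sum_ga (H al ga * x i ga) nu.+1 =
      \sum_(t < nu.+2) \sum_ga H al ga (nu.+1 - t)%N * x i ga t.
    rewrite [RHS]exchange_big; apply: eq_bigr => ga _; rewrite mulrC fpsM.
    by apply: eq_bigr => t _; exact: mulrC.
  rewrite [s * _]mulrC fpsM -sumrB; apply: eq_bigr => t _.
  rewrite tens_coefP (tens_coef_ad1 basis_e orthonormal_e) addrC.
  congr (_ + _); rewrite fpsB fpsCM /fps_euler.
  rewrite -[x i al t]/(tens_coef e al be (r (t%:Z - B%:Z) k)).
  by rewrite -mulrBl -!mulNr opprB mulrAC.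
have rhsE : \sum_(j < k.+2) tens_coef e al be
     ((j%:R * s (k.+1 - j)%N) *: r (nu%:Z - B%:Z) j
     + ad2 (eta (k.+1 - j)) (r (nu%:Z - B%:Z) j)) =
    - \sum_j (fpsC (M i j) * x j al) nu.
  (* The term j = k + 1 vanishes because s_0 = 0 and [eta 0] = 0. This keeps the system within the
     coefficients of z^j with j <= k. *)
  rewrite big_ord_recr /= subnn s0 mulr0 scale0r add0r eta0.
  rewrite (bilinear0l (ad2_bilinear L)) linear0 addr0.
  under [in RHS]eq_bigr => j _ do rewrite fpsCM.
  rewrite -(pair_bigA _ (fun (j : 'I_B) ga => M i (j, ga) * x (j, ga) al nu)) /=.
  rewrite -sumrN.
  rewrite (big_ord_widen B (fun j => tens_coef e al be
     ((j%:R * s (k.+1 - j)%N) *: r (nu%:Z - B%:Z) j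
     + ad2 (eta (k.+1 - j)) (r (nu%:Z - B%:Z) j)))) //.
  rewrite big_mkcond; apply: eq_bigr => j _; rewrite ltnS /M /=.
  case: ifP => jk; last by rewrite big1 ?oppr0 // => ga _; rewrite mul0r.
  rewrite tens_coefP (tens_coef_ad2 basis_e orthonormal_e) -sumrN.
  under [in RHS]eq_bigr => ga _ do rewrite mulNr opprK mulrDl.
  rewrite big_split; congr (_ + _).
  rewrite (bigD1 be) //= eqxx big1 ?addr0 // => ga /negPf ->.
  by rewrite mul0r.
move: e3; rewrite lhsE rhsE => /eqP.
by rewrite subr_eq addrC -subr_eq opprK eq_sym addrC => /eqP.
Qed.

Let f (i j : I) : fps F := \sum_al x i al * x j al.

Let f_eq i i' n : shifted_deriv s (B + B) (f i i') n =
  \sum_j M i j * f j i' n + \sum_j M i' j * f i j n.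
Proof. exact: shifted_deriv_contraction H_anti x_eq i i' n. Qed.

(** In the coefficient of y^(m+a) the power x^(-i-1) carries s_(m+a-i), which is 0 for i > a. So the
    leading term is s_m Omega x^(-a-1). *)
Let x_low (a : nat) (aB : (m + a < B)%N) be al (t : nat) : (t < B - a.+1)%N ->
  x (Ordinal aB, be) al t = 0.
Proof.
move=> ta; rewrite /x /=.
have -> : t%:Z - B%:Z = Negz (B - t.+1)%N by lia.
rewrite /r pole_series_neg; case: ifP => tm; last by rewrite scale0r linear0.
by rewrite s_m.1 ?scale0r ?linear0 //; lia.
Qed.

Let x_lead (a : nat) (aB : (m + a < B)%N) be al :
  x (Ordinal aB, be) al (B - a.+1)%N = s m * (al == be)%:R.
Proof.
rewrite /x /=.
have -> : (B - a.+1)%N%:Z - B%:Z = Negz a by lia.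
rewrite /r pole_series_neg leq_addl addnK linearZ.
by rewrite -(tens_coef_casimir orthonormal_e).
Qed.

(** Both vectors start in the direction e_be0, which pairs to 1 with itself. The Laurent order is
    -(a+b+2), and B = m + 2 leaves room for a, b in {0, 1}. *)
Let f_order (a b : nat) (aB : (m + a < B)%N) (bB : (m + b < B)%N) :
  zero_mult (f (Ordinal aB, be0) (Ordinal bB, be0)) (B + B - (a + b + 2)).
Proof.
have -> : (B + B - (a + b + 2) = (B - a.+1) + (B - b.+1))%N by lia.
have prod al := zero_multM (@x_low a aB be0 al) (@x_low b bB be0 al).
split=> [n nlt|].
  by rewrite /f fps_sumE big1 // => al _; rewrite (prod al).1.
rewrite /f fps_sumE (bigD1 be0) //= big1 ?addr0.
  by rewrite (prod be0).2 !x_lead eqxx !mulr1 mulf_neq0 // s_m.2.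
by move=> al /negPf al0; rewrite (prod al).2 !x_lead al0 mulr0 mul0r.
Qed.

Let J := (I * I)%type.
Let u (p : 'I_#|{: J}|) : fps F := f (enum_val p).1 (enum_val p).2.
Let N : 'M[F]_#|{: J}| := \matrix_(p, q)
  (let: (i, i') := enum_val p in let: (j, j') := enum_val q in
   (if i' == j' then M i j else 0) + (if i == j then M i' j' else 0)).

Let u_eq p n : shifted_deriv s (B + B) (u p) n = \sum_q N p q * u q n.
Proof.
rewrite /u; move: (f) f_eq => f' f'_eq; rewrite f'_eq.
case pE : (enum_val p) => [i i'].
pose Y (q : J) := ((if i' == q.2 then M i q.1 else 0) +
  (if i == q.1 then M i' q.2 else 0)) * f' q.1 q.2 n.
transitivity (\sum_q Y q); last first.
  rewrite [LHS](_ : _ = \sum_(q in {: J}) Y q); last by apply: eq_bigl.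
  rewrite big_enum_val; apply: eq_bigr => q _.
  by rewrite mxE pE /Y; case: (enum_val q).
rewrite -(pair_bigA _ (fun j j' => Y (j, j'))) /=.
under [RHS]eq_bigr => j _ do under eq_bigr => j' _ do rewrite /Y mulrDl.
under [RHS]eq_bigr => j _ do rewrite big_split.
rewrite big_split /=; congr (_ + _).
  apply: eq_bigr => j _; rewrite (bigD1 i') //= eqxx big1 ?addr0 // => j' /negPf j'i'.
  by rewrite eq_sym j'i' mul0r.
rewrite exchange_big; apply: eq_bigr => j' _.
rewrite (bigD1 i) //= eqxx big1 ?addr0 // => j /negPf ji.
by rewrite eq_sym ji mul0r.
Qed.

Let u_rank (i j : I) : u (enum_rank (i, j)) = f i j.
Proof. by rewrite /u enum_rankK. Qed.

(** The pairings for (y^m, y^m) and (y^m, y^(m+1)) have Laurent orders -2 and -3, and both must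
    reach 0 in steps of m - 1. *)
Lemma cybe_mult_le2 : (m <= 2)%N.
Proof.
rewrite leqNgt; apply/negP => m2.
have p0 : (m + 0 < B)%N by lia.
have p1 : (m + 1 < B)%N by lia.
have := f_order p0 p0; have := f_order p0 p1; rewrite -!u_rank => u3 u2.
have [k3 e3] := finite_orbit_mult charF0 u_eq m_gt1 s_m u3.
have [k2 e2] := finite_orbit_mult charF0 u_eq m_gt1 s_m u2.
have d3 : (m.-1 %| 3)%N by apply/dvdnP; exists k3; lia.
have d2 : (m.-1 %| 2)%N by apply/dvdnP; exists k2; lia.
by have := dvdn_sub d3 d2; rewrite dvdn1 => /eqP; lia.
Qed.

Lemma cybe_mult2_coef3 : m = 2%N -> s 3%N = 0.
Proof.
move=> m2; have p0 : (m + 0 < B)%N by lia.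
have := f_order p0 p0; rewrite -u_rank => u2.
apply: (finite_orbit_mult2 charF0 u_eq _ _ u2); last by lia.
by rewrite -m2.
Qed.

End Multiplicity.

(** * Conclusion *)

Lemma transforms_to_normal_form (F : fieldType) (charF0 : [pchar F] =i pred0)
    (V : lmodType F) (Om : V) (s : fps F) (g : nat -> nat -> V) (m : nat) :
  zero_mult s m -> (m <= 2)%N -> (m = 2%N -> s 3%N = 0) ->
  transforms_to Om (pole_series Om s g) (fpsX F ^+ m).
Proof.
move=> s_m; case: m s_m => [|[|[|m]]] // [s_low sm_neq0] _ s3.
- have [psi [psi_coord ode]] := normal_form_mult0 charF0 sm_neq0.
  exact: transforms_to_pole_series psi_coord (oner_neq0 _) ode.
- have [psi [psi_coord ode]] := normal_form_mult1 charF0 (s_low 0%N isT) sm_neq0.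
  by apply: transforms_to_pole_series psi_coord _ ode; rewrite ?invr_eq0.
- have [psi [psi_coord ode]] :=
    normal_form_mult2 charF0 (s_low 0%N isT) (s_low 1%N isT) sm_neq0 (s3 erefl).
  by apply: transforms_to_pole_series psi_coord _ ode; rewrite ?invr_eq0.
Qed.

Lemma transforms_to_zero (F : fieldType) (charF0 : [pchar F] =i pred0)
    (V : lmodType F) (Om : V) (g : nat -> nat -> V) :
  transforms_to Om (pole_series Om 0 g) 0.
Proof.
apply: (@transforms_to_pole_series _ _ Om charF0 _ _ _ (fpsX F) 1).
- by split=> //; exact: oner_neq0.
- exact: oner_neq0.
by move=> n; rewrite mulr0 big1 ?mulr0 // => k _; rewrite mul0r.
Qed.

Lemma fps_eq0_or_zero_mult (F : fieldType) (s : fps F) :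
  s = 0 \/ exists m, zero_mult s m.
Proof.
have [[n sn]|s0] := pselect (exists n, s n != 0); last first.
  left; apply/funext => n; apply/eqP; apply: contraT => sn.
  by case: s0; exists n.
right; have exn : exists n, s n != 0 by exists n.
exists (ex_minn exn); case: ex_minnP => m sm m_min; split=> // i im.
by apply/eqP; apply: contraTT im => si; rewrite -leqNgt m_min.
Qed.

Lemma lie_simple_dim (F : fieldType) (L : lieAlgType F) :
  lie_simple L -> (0 < \dim {:L})%N.
Proof.
case=> [[x [y xy]] _]; rewrite lt0n; apply: contraNneq xy => /eqP.
rewrite dimv_eq0 => /eqP L0; have := memvf x; rewrite L0 memv0 => /eqP ->.
by rewrite lieC linear0 oppr0.
Qed.

Theorem corollary3 (F : closedFieldType) (charF0 : [pchar F] =i pred0)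
    (L : lieAlgType F) (simpleL : lie_simple L)
    (e : (\dim {:L}).-tuple L) (basis_e : basis_of {:L} e)
    (orthonormal_e : killing_orthonormal e)
    (s : fps F) (g : nat -> nat -> tensor L L) :
  let Omega : tensor L L := \sum_(x <- e) x ⊗ x in
  let r := pole_series Omega s g in
  CYBE r ->
  [/\ s = 0 \/ (exists2 m, (m <= 2)%N & zero_mult s m),
      exists t : fps F,
        [\/ t = 0, t = 1, t = fpsX F | t = fpsX F ^+ 2] /\
        transforms_to Omega r t &
      zero_mult s 2 -> (transforms_to Omega r (fpsX F ^+ 2) <-> s 3%N = 0)].

Proof.
move=> Omega r cybe_r.
have be0 : 'I_(\dim {:L}) := Ordinal (lie_simple_dim simpleL).
have mult m : zero_mult s m -> (m <= 2)%N /\ (m = 2%N -> s 3%N = 0).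
  (* For m <= 1 both claims are immediate; the orbit argument covers m > 1. *)
  move=> s_m; case: (ltnP 1 m) => m1; last by split; lia.
  split; first exact: cybe_mult_le2 be0 cybe_r m1 s_m.
  exact: cybe_mult2_coef3 be0 cybe_r m1 s_m.
split.
- have [->|[m s_m]] := fps_eq0_or_zero_mult s; first by left.
  by right; exists m => //; exact: (mult m s_m).1.
- have [s0|[m s_m]] := fps_eq0_or_zero_mult s.
    exists 0; split; first by constructor.
    by rewrite /r s0; exact: transforms_to_zero.
  have [m2 s3] := mult m s_m; exists (fpsX F ^+ m); split.
    by case: m m2 {s_m s3} => [|[|[|m]]] // _; [constructor 2|constructor 3|constructor 4].
  exact: transforms_to_normal_form.
(* For a double zero the Yang-Baxter equation itself forces s_3 = 0, so both sides of the
   equivalence hold. *)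
- move=> s2; have [_ s3] := mult 2%N s2; split=> [_|_]; first exact: s3.
  exact: transforms_to_normal_form.
Qed.
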